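(* Let $Q(x,y,z)$ be an irreducible (i.e. non-degenerate) complex quadratic form. (1) The space of complex homogeneous polynomials admits an $O_Q(3;\mathbb C)$-invariant decomposition $$V(d)=\bigoplus_{d-2k\ge0}Q^k\cdot Har_Q(d-2k).$$ The summands are orthogonal with respect to the Hermitian inner product $\langle f,g\rangle=\int_{\Upsilon_Q}f\cdot\bar g\,dm_Q$. In particular, the homogeneous polynomials $P\in Har_Q(d)$ (the solutions of $\Delta_Q(P)=0$) are characterized by the property: for each $T\in V_Q(d)$, $\int_{\Upsilon_Q}P\cdot\bar T\,dm_Q=0$. (2) Any polynomial function $F$ on the surface $\mathcal S=\{Q(x,y,z)=const\}$ can be obtained by restricting to $\mathcal S$ a polynomial $P\in Ker(\Delta_Q)$ (not necessarily homogeneous). (3) For any two polynomials $M$ and $N$, the ''complex Dirichlet problem'' $$\{\Delta_Q(P)=M,\quad P|_{\mathcal S}=N|_{\mathcal S}\}$$ has a unique polynomial solution $P$. (4) Any polynomial solution $P$ of the equation $\Delta_Q(P)=0$, $\deg(P)\le d$ (equivalently, any polynomial $P$ of degree $d$ at most, being restricted to the surface $\mathcal S$), admits a Maxwell-type representation $$P(x,y,z)=\sum_{d-2k\ge0}Q(x,y,z)^{d-k+\frac12}\cdot\nabla_{\mathbf u_{1,k}}\nabla_{\mathbf u_{2,k}}\cdots\nabla_{\mathbf u_{d-2k,k}}\Big(Q(x,y,z)^{-\frac12}\Big),$$ where $\mathbf u_{j,k}$ are appropriate vectors in $\mathbb C^3$.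
   Context: $V(d)$ is the space of homogeneous complex polynomials of degree $d$ in $x,y,z$; $V_Q(d)=Q\cdot V(d-2)$. Write $Q(v)=vBv^T$ with $v=(x,y,z)$ and $B$ a symmetric invertible matrix, and write $B=AA^T$ with $A\in GL(3;\mathbb C)$, so that $Q(v)=x'^2+y'^2+z'^2$ for $(x',y',z')=vA$. $\Delta_Q=\sum_{j,k}b^{jk}\partial_j\partial_k$, where $(b^{jk})=B^{-1}$ and $(\partial_1,\partial_2,\partial_3)=(\partial_x,\partial_y,\partial_z)$. $Ker(\Delta_Q)$ is the space of complex polynomials annihilated by $\Delta_Q$, and $Har_Q(m)=Ker(\Delta_Q)\cap V(m)$. $O_Q(3;\mathbb C)\subset GL(3;\mathbb C)$ is the subgroup preserving $Q$, acting on polynomials by linear change of variables. $\Upsilon_Q=\{v\in\mathbb C^3: vA\in\mathbb R^3,\ Q(v)=1\}$ is the image of the unit sphere $S^2\subset\mathbb R^3$ under $A^{-1}$, and $dm_Q$ is the pull-back under $v\mapsto vA$ of the standard rotation-invariant measure $dm$ on $S^2$; thus $\int_{\Upsilon_Q}f\bar g\,dm_Q=\int_{S^2}f(uA^{-1})\overline{g(uA^{-1})}\,dm(u)$. $\nabla_{\mathbf u}$ is the directional derivative along $\mathbf u$. In the Maxwell-type formula the same (local) branch of $Q^{1/2}$ is used in both places of each term, so the sign ambiguities cancel.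
   Formalization: Part (4) fails as printed (d=1, P=1+x; d=0, P=2). Here the order-0 term has a complex coefficient; for deg P ≤ d (harmonic, or restricted to S) terms have d-k derivatives, k=0..d; with d-2k derivatives as printed it is proved for homogeneous P of degree d. *)

(* Defs.v *)
(* mpoly is imported without its notations, which clash with those of
   MathComp-Analysis. *)
From HB Require Import structures.
From mathcomp Require Import all_boot all_order all_algebra.
From mathcomp Require Import all_classical all_reals all_analysis.
From mathcomp Require Import complex.
From mathcomp Require Import -(notations) mpoly.

Set Implicit Arguments.
Unset Strict Implicit.
Unset Printing Implicit Defensive.

Import Order.TTheory GRing.Theory Num.Theory.
Import numFieldNormedType.Exports.

Local Open Scope classical_set_scope.
Local Open Scope ring_scope.

(* The complex numbers R[i], packaged as a numClosedFieldType so that the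
   generic normed-module structures of MathComp-Analysis apply: topology,
   continuity and derivatives over Cx R are the complex ones. *)
Definition Cx (R : realType) : numClosedFieldType := R[i].

Section Quadratic.
Variable R : realType.
Local Notation C := (Cx R).

(* {mpoly C[3]}, with x = 'X_0, y = 'X_1, z = 'X_2. *)
Definition poly3 := mpoly 3 C.

Definition var (i : 'I_3) : poly3 := mpolyX C (mnm1 i).

Definition pval (P : poly3) (v : 'rV[C]_3) : C := meval (fun i => v 0 i) P.

Definition V (d : nat) (P : poly3) : Prop := P \is ishomog1 d (@mdeg 3).

Definition deg_le (d : nat) (P : poly3) : Prop := (mmeasure (@mdeg 3) P <= d.+1)%N.

Section Form.
Variable B : 'M[C]_3.

Definition Qf : poly3 := \sum_i \sum_j B i j *: (var i * var j).

Lemma pval_Qf (v : 'rV[C]_3) : pval Qf v = (v *m B *m v^T) 0 0.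
Proof.
rewrite /pval /Qf exchange_big /= raddf_sum mxE; apply: eq_bigr => j _.
rewrite raddf_sum !mxE big_distrl /=; apply: eq_bigr => i _.
by rewrite mevalZ mevalM !mevalXU mulrCA mulrA.
Qed.

(* V(d - 2) is the zero space when d < 2. *)
Definition VQ (d : nat) (T : poly3) : Prop :=
  if d is e.+2 then exists2 S, V e S & T = Qf * S else T = 0.

Definition lap (P : poly3) : poly3 :=
  \sum_j \sum_k invmx B j k *: mderiv j (mderiv k P).

Definition Ker (P : poly3) : Prop := lap P = 0.

Definition Har (m : nat) (P : poly3) : Prop := Ker P /\ V m P.

Definition QHar (d k : nat) (P : poly3) : Prop :=
  exists2 H, Har (d - 2 * k) H & P = Qf ^+ k * H.

(* P(v) |-> P(v g), for row vectors v. *)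
Definition act (g : 'M[C]_3) (P : poly3) : poly3 :=
  comp_mpoly [tuple \sum_i g i j *: var i | j < 3] P.

Definition OQ (g : 'M[C]_3) : Prop := g \in unitmx /\ act g Qf = Qf.

Definition surface (c : C) : set 'rV[C]_3 := [set v | pval Qf v = c].

(* s is a continuous branch of Q^(1/2) on the open set U, off the cone Q = 0. *)
Definition sqrt_branch (U : set 'rV[C]_3) (s : 'rV[C]_3 -> C) : Prop :=
  open U /\
  (forall v, U v ->
     [/\ {for v, continuous s}, s v != 0 & s v ^+ 2 = pval Qf v]).

End Form.

(* Integration over the unit sphere against the surface measure
   dm = sin(theta) dtheta dphi, in spherical coordinates. *)
Definition sphere_point (theta phi : R) : 'rV[R]_3 :=
  \row_(i < 3) [:: sin theta * cos phi; sin theta * sin phi; cos theta]`_i.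

Definition sphere_Rint (f : 'rV[R]_3 -> R) : R :=
  (\int[lebesgue_measure]_(theta in `[0, pi])
     ((\int[lebesgue_measure]_(phi in `[0, 2 * pi])
         f (sphere_point theta phi)) * sin theta))%R.

Definition sphere_int (f : 'rV[R]_3 -> C) : C :=
  Complex (sphere_Rint (fun u => complex.Re (f u)))
          (sphere_Rint (fun u => complex.Im (f u))).

(* The integral over Upsilon_Q against dm_Q, where B = A *m A^T. *)
Definition Upsilon_int (A : 'M[C]_3) (f : 'rV[C]_3 -> C) : C :=
  sphere_int (fun u => f (map_mx (real_complex R) u *m invmx A)).

Definition herm (A : 'M[C]_3) (f g : poly3) : C :=
  Upsilon_int A (fun v => pval f v * (pval g v)^*).

Definition nabla (us : seq 'rV[C]_3) (f : 'rV[C]_3 -> C) : 'rV[C]_3 -> C :=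
  foldr (fun u (g : 'rV[C]_3 -> C) v => 'D_u g v : C) f us.

(* Q^(e + 1/2) * nabla_(u_1) ... nabla_(u_m) (Q^(-1/2)) at v, where s is the
   branch of Q^(1/2).  For m = 0 there is no vector to absorb a scalar (the
   term is Q^e), hence the coefficient lam in that case only. *)
Definition maxwell_term (s : 'rV[C]_3 -> C) (lam : C) (e m : nat)
    (u : nat -> 'rV[C]_3) (v : 'rV[C]_3) : C :=
  (if m == 0%N then lam else 1) * s v ^+ (2 * e).+1 *
  nabla [seq u j | j <- iota 1 m] (fun w => (s w)^-1) v.

(* n terms, of exponents d - k + 1/2 and of orders m k, for 0 <= k < n;
   u j k is the vector u_(j, k). *)
Definition maxwell_rep (B : 'M[C]_3) (d n : nat) (m : nat -> nat)
    (P : poly3) : Prop :=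
  exists (lam : C) (u : nat -> nat -> 'rV[C]_3),
  forall U s, sqrt_branch B U s -> forall v, U v ->
    pval P v = \sum_(0 <= k < n) maxwell_term s lam (d - k) (m k) (u^~ k) v.

End Quadratic.

(* Main.v *)
From HB Require Import structures.
Require Import Defs.
From mathcomp Require Import all_boot all_order all_algebra.
From mathcomp Require Import all_classical all_reals all_analysis.
From mathcomp Require Import complex.
From mathcomp Require Import -(notations) mpoly.
From mathcomp Require Import ring lra zify.

(** Everything rests on the identity, for H harmonic and homogeneous of degree m,
      Laplacian (Q^(k+1) H) = 2 (k+1) (2k + 2m + 3) Q^k H      ([lap_QX]),
    which follows from Euler's formula. Since the factor is nonzero, induction
    on the degree shows that every homogeneous polynomial is, in a unique way,
    a sum of terms Q^k H ([harmonic_decomposition],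
    [harmonic_decomposition_inj]); the decomposition is invariant because the
    Laplacian commutes with the linear maps preserving Q ([lap_act]).

    Dirichlet problem. Replacing Q^k H by c^k H in the decomposition does not
    change the values on the surface Q = c and gives a harmonic polynomial
    ([harmonic_restriction]). For uniqueness, a polynomial vanishing on Q = c
    is a multiple (Q - c) S ([surface_null]): after reduction of Q to
    y^2 - x z this is division with respect to y. If (Q - c) S is harmonic,
    then the top homogeneous component T of S satisfies
    Laplacian (Q T) = 0, so T = 0 ([lap_QfcM_inj]).

    Maxwell representation. On any branch of Q^(1/2), the product of
    Q^(m + 1/2) and of m derivatives of Q^(-1/2) is a harmonic polynomial of
    degree m, given by the recursion [maxwell_poly], and modulo Q it is a
    product of m linear forms, which can be prescribed ([maxwell_poly_mod]).
    Conversely the restriction of a harmonic H of degree m to the cone Q = 0,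
    parametrized by (1, t, t^2), is a polynomial of degree at most 2m in t;
    factoring it into quadratic polynomials shows that H is a product of m
    linear forms modulo Q ([cone_linear_factors]). The difference of H and of
    the corresponding Maxwell polynomial is harmonic and divisible by Q,
    hence zero ([harmonic_maxwell_poly]).

    Orthogonality. In the coordinates v A the Hermitian product is an integral
    over the real unit sphere, where Q = 1. Integration by parts in spherical
    coordinates shows that the integral of an infinitesimal rotation of a
    polynomial is zero ([sphere_mom_rot]). The sum of the squares of the
    infinitesimal rotations is therefore symmetric, and it acts on harmonic
    polynomials of degree m by - m (m + 1), so that different degrees are
    orthogonal ([sphere_mom_Har]). The product is positive definite on
    homogeneous polynomials ([sphere_mom_definite]), which yields the
    characterization of harmonic polynomials by orthogonality to Q V(d - 2). *)

Set Implicit Arguments.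
Unset Strict Implicit.
Unset Printing Implicit Defensive.
Import Order.TTheory GRing.Theory Num.Theory.
Import numFieldNormedType.Exports.
Local Open Scope classical_set_scope.
Local Open Scope ring_scope.

(** * Laplacian, Euler field and powers of the quadratic form *)

(** Differential calculus in a commutative algebra A with commuting derivations
    D i dual to elements x i; the polynomial algebra is the instance of
    interest. *)
Section AbstractCalculus.
Variables (F : fieldType) (A : comAlgType F) (D : 'I_3 -> {linear A -> A}).
Variables (x : 'I_3 -> A) (B : 'M[F]_3).
Hypothesis D_mul : forall i a b, D i (a * b) = D i a * b + a * D i b.
Hypothesis D_x : forall i j, D i (x j) = (j == i)%:R.
Hypotheses (B_sym : B^T = B) (B_unit : B \in unitmx).
Implicit Types a b : A.

(** The quadratic form with matrix B, its Laplace operator (which involves the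
    inverse matrix) and the Euler field. *)
Definition alg_form : A := \sum_i \sum_j B i j *: (x i * x j).
Definition alg_lap a : A := \sum_j \sum_k invmx B j k *: D j (D k a).
Definition alg_euler a : A := \sum_i x i * D i a.

(** The bilinear pairing of gradients defined by the inverse matrix of B. *)
Definition alg_grad a b : A := \sum_j \sum_k invmx B j k *: (D j a * D k b).

Lemma invB_sym i j : invmx B i j = invmx B j i.
Proof. by rewrite -[in RHS]B_sym -trmx_inv mxE. Qed.

Lemma invB_B i l : \sum_k invmx B i k * B k l = (i == l)%:R.
Proof.
by have := congr1 (fun M : 'M[F]_3 => M i l) (mulVmx B_unit); rewrite !mxE.
Qed.

Lemma alg_gradC a b : alg_grad a b = alg_grad b a.
Proof.
rewrite /alg_grad exchange_big; apply: eq_bigr => i _; apply: eq_bigr => j _.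
by rewrite invB_sym mulrC.
Qed.

Lemma alg_lapM a b :
  alg_lap (a * b) = alg_lap a * b + alg_grad a b *+ 2 + a * alg_lap b.
Proof.
rewrite mulr2n {2}alg_gradC /alg_lap /alg_grad mulr_suml mulr_sumr -!big_split /=.
apply: eq_bigr => i _; rewrite mulr_suml mulr_sumr -!big_split /=.
apply: eq_bigr => j _.
rewrite D_mul linearD /= !D_mul -scalerAl -scalerAr -!scalerDr.
by congr (_ *: _); ring.
Qed.

Lemma D_form i : D i alg_form = (\sum_j B i j *: x j) *+ 2.
Proof.
rewrite /alg_form linear_sum /=.
under eq_bigr => k _ do rewrite linear_sum /=.
under eq_bigr => k _ do under eq_bigr => l _ do
  rewrite linearZ /= D_mul !D_x scalerDr.
under eq_bigr => k _ do rewrite big_split /=.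
rewrite big_split mulr2n /=; congr (_ + _).
  rewrite (bigD1 i) //= [X in _ + X]big1 ?addr0; last first.
    by move=> k /negPf ki; rewrite big1 // => l _; rewrite ki mul0r scaler0.
  by apply: eq_bigr => l _; rewrite eqxx mul1r.
apply: eq_bigr => k _; rewrite (bigD1 i) //= big1 ?addr0; last first.
  by move=> l /negPf li; rewrite li mulr0 scaler0.
by rewrite eqxx mulr1 -[in LHS]B_sym mxE.
Qed.

(** The gradient of the form is twice the radial field. *)
Lemma alg_grad_form a : alg_grad a alg_form = alg_euler a *+ 2.
Proof.
rewrite /alg_grad /alg_euler -sumrMnl; apply: eq_bigr => j _.
under eq_bigr => k _ do rewrite D_form mulrnAr -scalerMnr mulr_sumr.
rewrite sumrMnl; congr (_ *+ 2).
under eq_bigr => k _ do rewrite scaler_sumr.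
rewrite exchange_big /= (bigD1 j) //= [X in _ + X]big1 ?addr0.
  under eq_bigr => k _ do rewrite -scalerAr scalerA.
  by rewrite -scaler_suml invB_B eqxx scale1r mulrC.
move=> i /negPf ij.
under eq_bigr => k _ do rewrite -scalerAr scalerA.
by rewrite -scaler_suml invB_B eq_sym ij scale0r.
Qed.

Lemma D_D_form i j : D i (D j alg_form) = B j i *: 1 *+ 2.
Proof.
rewrite D_form linearMn linear_sum /=; congr (_ *+ _).
rewrite (bigD1 i) //= [X in _ + X]big1 ?addr0; last first.
  by move=> l /negPf lj; rewrite linearZ /= D_x lj scaler0.
by rewrite linearZ /= D_x eqxx.
Qed.

Lemma alg_lap_form : alg_lap alg_form = 6%:R.
Proof.
rewrite /alg_lap.
under eq_bigr => j _ do under eq_bigr => k _ do rewrite D_D_form -scalerMnr scalerA.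
under eq_bigr => j _ do
  rewrite sumrMnl -scaler_suml invB_B eqxx scale1r.
by rewrite sumr_const card_ord -mulrnA.
Qed.

(** The hypothesis says that a is homogeneous of degree d. *)
Lemma alg_lap_formM d a : alg_euler a = d%:R *: a ->
  alg_lap (alg_form * a) = (6 + 4 * d)%:R *: a + alg_form * alg_lap a.
Proof.
move=> e; rewrite alg_lapM alg_lap_form alg_gradC alg_grad_form e -mulrnA.
congr (_ + _); rewrite !scaler_nat mulr_natl -mulrnA -mulrnDr.
by congr (_ *+ _); lia.
Qed.

(** The derivative of a along the vector u. *)
Definition alg_Ddir (u : 'rV[F]_3) a : A := \sum_i u 0 i *: D i a.

Lemma alg_grad_Ddir_form (u : 'rV[F]_3) a :
  alg_grad a (alg_Ddir u alg_form) = alg_Ddir u a *+ 2.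
Proof.
rewrite /alg_grad /alg_Ddir -sumrMnl; apply: eq_bigr => j _.
have e k : D k (\sum_i u 0 i *: D i alg_form) = (\sum_i u 0 i * B k i) *: 1 *+ 2.
  rewrite linear_sum scaler_suml -sumrMnl; apply: eq_bigr => i _ /=.
  by rewrite linearZ /= D_D_form -scalerMnr scalerA -[in RHS]B_sym mxE.
under eq_bigr => k _ do rewrite e mulrnAr -scalerAr mulr1 -scalerMnr scalerA.
rewrite sumrMnl -scaler_suml; congr (_ *: _ *+ _).
under eq_bigr => k _ do rewrite mulr_sumr.
rewrite exchange_big /= (bigD1 j) //= [X in _ + X]big1 ?addr0.
  under eq_bigr => k _ do rewrite mulrCA.
  by rewrite -mulr_sumr invB_B eqxx mulr1.
move=> i /negPf ij; under eq_bigr => k _ do rewrite mulrCA.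
by rewrite -mulr_sumr invB_B eq_sym ij mulr0.
Qed.

(** The Laplacian commutes with a linear change of variables g. *)
Lemma alg_lap_chain (g : 'M[F]_3) (phi : {linear A -> A}) a :
  g \in unitmx ->
  (forall i b, D i (phi b) = \sum_k g i k *: phi (D k b)) ->
  \sum_j \sum_k invmx (g *m B *m g^T) j k *: D j (D k (phi a)) = phi (alg_lap a).
Proof.
move=> gU chain; set b' := invmx _.
have eb l k : \sum_j \sum_i g i l * b' i j * g j k = invmx B l k.
  have gT : g^T \in unitmx by rewrite unitmx_tr.
  have -> : invmx B = g^T *m b' *m g.
    have bU : g *m B *m g^T \in unitmx by rewrite !unitmx_mul gU B_unit gT.
    have : g^T *m b' *m (g *m B *m g^T) *m invmx g^T = 1%:M.
      by rewrite -(mulmxA g^T) mulVmx // mulmx1 mulmxV.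
    rewrite !mulmxA mulmxK // => e.
    by rewrite -[LHS]mul1mx -e mulmxK.
  rewrite !mxE; apply: eq_bigr => j _; rewrite !mxE mulr_suml.
  by apply: eq_bigr => i _; rewrite !mxE.
transitivity (\sum_l \sum_k (\sum_j \sum_i g i l * b' i j * g j k) *:
  phi (D l (D k a))); last first.
  rewrite /alg_lap linear_sum; apply: eq_bigr => l _ /=.
  rewrite linear_sum; apply: eq_bigr => k _ /=.
  by rewrite linearZ /= eb.
have E i j : b' i j *: D i (D j (phi a)) =
    \sum_l \sum_k (g i l * b' i j * g j k) *: phi (D l (D k a)).
  rewrite chain linear_sum scaler_sumr exchange_big; apply: eq_bigr => k _ /=.
  rewrite linearZ /= chain scalerA scaler_sumr; apply: eq_bigr => l _.
  by rewrite scalerA; congr (_ *: _); ring.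
under eq_bigr => i _ do under eq_bigr => j _ do rewrite E.
under [RHS]eq_bigr => l _ do under eq_bigr => k _ do rewrite scaler_suml.
under [RHS]eq_bigr => l _ do under eq_bigr => k _ do
  under eq_bigr => j _ do rewrite scaler_suml.
under eq_bigr => i _ do rewrite exchange_big /=.
rewrite exchange_big /=; apply: eq_bigr => l _.
under eq_bigr => i _ do rewrite exchange_big /=.
rewrite exchange_big /=; apply: eq_bigr => k _.
by rewrite exchange_big.
Qed.

(** The chain rule for a substitution phi passes to products. *)
Lemma alg_chain_mul (g : 'M[F]_3) (phi : {linear A -> A}) i a b :
  {morph phi : c d / c * d} ->
  D i (phi a) = \sum_k g i k *: phi (D k a) ->
  D i (phi b) = \sum_k g i k *: phi (D k b) ->
  D i (phi (a * b)) = \sum_k g i k *: phi (D k (a * b)).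
Proof.
move=> phiM ha hb; rewrite phiM D_mul ha hb mulr_suml mulr_sumr -big_split.
apply: eq_bigr => k _ /=.
by rewrite D_mul linearD !phiM /= scalerDr -scalerAl -scalerAr.
Qed.

End AbstractCalculus.

Section Calculus.
Variable R : realType.
Local Notation C := (Cx R).
Implicit Types (P S H : poly3 R) (d m k : nat).

Lemma V0 d : V d (0 : poly3 R).
Proof. exact: dhomog0. Qed.

Lemma VD d P S : V d P -> V d S -> V d (P + S).
Proof. exact: dhomogD. Qed.

Lemma VZ d (c : C) P : V d P -> V d (c *: P).
Proof. exact: dhomogZ. Qed.

Lemma VN d P : V d P -> V d (- P).
Proof. by rewrite -scaleN1r; apply: VZ. Qed.

Lemma VM d e P S : V d P -> V e S -> V (d + e) (P * S).
Proof. exact: dhomogM. Qed.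

Lemma VX d k P : V d P -> V (d * k) (P ^+ k).
Proof. exact: dhomogMn. Qed.

Lemma V_sum (I : Type) (r : seq I) (p : pred I) (F : I -> poly3 R) d :
  (forall i, p i -> V d (F i)) -> V d (\sum_(i <- r | p i) F i).
Proof. move=> h; apply: big_ind => //; [exact: V0 | exact: VD]. Qed.

Lemma V_var (i : 'I_3) : V 1 (var R i).
Proof. by rewrite /V /var dhomogX /= mdeg1. Qed.

Lemma mderiv_var (i j : 'I_3) : mderiv i (var R j) = (j == i)%:R.
Proof.
rewrite /var mderivX mnm1E; case: eqVneq => [->|_]; last by rewrite scale0r.
rewrite scale1r (_ : mnm_sub _ _ = mnm0) ?mpolyX0 //.
by apply/mnmP => k; rewrite mnmBE mnm0E subnn.
Qed.

Lemma V_mderiv d i P : V d.+1 P -> V d (mderiv i P).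
Proof.
move=> /dhomogP hP; rewrite /V [P]mpolyE !linear_sum /=.
apply: V_sum => m _.
have [/hP hm|/memN_msupp_eq0 ->] := boolP (m \in msupp P); last first.
  by rewrite scale0r linear0; exact: V0.
rewrite linearZ /=; apply: VZ; rewrite mderivX.
have [->|nz] := eqVneq (m i) 0%N; first by rewrite scale0r; exact: V0.
apply: VZ; rewrite /V dhomogX /=.
have le : lem (mnm1 i) m.
  apply/mnm_lepP => j; rewrite mnm1E; case: eqVneq => [<-|//].
  by rewrite lt0n.
have := mdegD (mnm_sub m (mnm1 i)) (mnm1 i).
by rewrite submK // hm mdeg1 addn1 => -[->].
Qed.

Lemma mderiv_V0 i P : V 0 P -> mderiv i P = 0.
Proof.
move=> /dhomogP hP; rewrite [P]mpolyE linear_sum /= big_seq big1 // => m /hP.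
move=> /eqP; rewrite mdeg_eq0 => /eqP ->.
by rewrite linearZ /= mderivX mnm0E scale0r scaler0.
Qed.

(** The Euler field of homogeneous functions. *)
Definition euler P : poly3 R := \sum_i var R i * mderiv i P.

Lemma euler_homog d P : V d P -> euler P = d%:R *: P.
Proof.
move=> /dhomogP hP; rewrite /euler.
have hi i : var R i * mderiv i P =
    \sum_(m <- msupp P) var R i * mderiv i (mcoeff m P *: mpolyX C m).
  by rewrite {1}[P]mpolyE linear_sum mulr_sumr.
rewrite (eq_bigr _ (fun i _ => hi i)) exchange_big [in RHS](mpolyE P) scaler_sumr /=.
apply: eq_big_seq => m /hP hm.
have {}hm : d = (\sum_i m i)%N by rewrite -mdegE.
rewrite scalerA (mulrC d%:R) -scalerA hm natr_sum scaler_suml scaler_sumr.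
apply: eq_bigr => i _; rewrite linearZ /= mderivX -scalerAr; congr (_ *: _).
rewrite -scalerAr; have [->|nz] := eqVneq (m i) 0%N; first by rewrite !scale0r.
rewrite /var -mpolyXD addmC submK //.
apply/mnm_lepP => j; rewrite mnm1E; case: eqVneq => [<-|//].
by rewrite lt0n.
Qed.

(** The derivative of a polynomial along a constant vector. *)
Definition Ddir (u : 'rV[C]_3) P : poly3 R := \sum_i u 0 i *: mderiv i P.

Lemma V_Ddir d u P : V d.+1 P -> V d (Ddir u P).
Proof. by move=> h; apply: V_sum => i _; apply/VZ/V_mderiv. Qed.

Lemma Ddir_V0 u P : V 0 P -> Ddir u P = 0.
Proof. by move=> h; rewrite /Ddir big1 // => i _; rewrite mderiv_V0 ?scaler0. Qed.

Lemma Ddir_linear u : linear (Ddir u).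
Proof.
move=> c P S; rewrite /Ddir scaler_sumr -big_split /=; apply: eq_bigr => i _.
by rewrite linearP scalerDr !scalerA mulrC.
Qed.
HB.instance Definition _ u :=
  GRing.isLinear.Build C (poly3 R) (poly3 R) _ (Ddir u) (@Ddir_linear u).

Lemma DdirM u P S : Ddir u (P * S) = Ddir u P * S + P * Ddir u S.
Proof.
rewrite /Ddir mulr_suml mulr_sumr -big_split /=; apply: eq_bigr => i _.
by rewrite mderivM scalerDr scalerAl scalerAr.
Qed.

Lemma Ddir_mderiv u i P : Ddir u (mderiv i P) = mderiv i (Ddir u P).
Proof.
rewrite /Ddir linear_sum /=; apply: eq_bigr => j _.
by rewrite linearZ /= mderiv_comm.
Qed.

End Calculus.

Section Laplacian.
Variable R : realType.
Local Notation C := (Cx R).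
Implicit Types (P S H : poly3 R) (d m k : nat).
Variable B : 'M[C]_3.

Lemma lap_linear : linear (lap B).
Proof.
move=> c P S; rewrite /lap scaler_sumr -big_split /=; apply: eq_bigr => i _.
rewrite scaler_sumr -big_split /=; apply: eq_bigr => j _.
by rewrite !linearP.
Qed.
HB.instance Definition _ :=
  GRing.isLinear.Build C (poly3 R) (poly3 R) _ (lap B) lap_linear.

Lemma V_Qf : V 2 (Qf B).
Proof.
apply: V_sum => i _; apply: V_sum => j _; apply: VZ.
exact: (VM (V_var R i) (V_var R j)).
Qed.

Lemma V_lap d P : V d.+2 P -> V d (lap B P).
Proof.
move=> h; apply: V_sum => i _; apply: V_sum => j _; apply: VZ.
by do 2 apply: V_mderiv.
Qed.

Lemma lap_small d P : (d < 2)%N -> V d P -> lap B P = 0.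
Proof.
move=> d2 h; rewrite /lap big1 // => i _; rewrite big1 // => j _.
case: d d2 h => [|[|//]] _ h; first by rewrite (mderiv_V0 _ h) linear0 scaler0.
by rewrite (mderiv_V0 _ (V_mderiv _ h)) scaler0.
Qed.

Lemma Ddir_lap u P : Ddir u (lap B P) = lap B (Ddir u P).
Proof.
rewrite /lap linear_sum; apply: eq_bigr => i _.
rewrite linear_sum; apply: eq_bigr => j _.
by rewrite linearZ /= !Ddir_mderiv.
Qed.

Hypotheses (B_sym : B^T = B) (B_unit : B \in unitmx).

(** The instance of [alg_grad] for polynomials. *)
Definition gradB P S : poly3 R :=
  alg_grad (@mderiv 3 C) B P S.

Lemma lapM P S : lap B (P * S) = lap B P * S + gradB P S *+ 2 + P * lap B S.
Proof. exact: (alg_lapM (@mderivM 3 C)). Qed.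

Lemma mderiv_Qf i : mderiv i (Qf B) = (\sum_j B i j *: var R j) *+ 2.
Proof. exact: (D_form (@mderivM 3 C) (@mderiv_var R) B_sym). Qed.

Lemma lap_Ddir_QfM u P : Ker B P ->
  lap B (P * Ddir u (Qf B)) = Ddir u P *+ 4.
Proof.
move=> kP; have e : gradB P (Ddir u (Qf B)) = Ddir u P *+ 2.
  exact: (alg_grad_Ddir_form (@mderivM 3 C) (@mderiv_var R) B_sym B_unit).
have z : lap B (Ddir u (Qf B)) = 0.
  exact: (@lap_small 1 _ isT (@V_Ddir R 1 u _ V_Qf)).
apply: (etrans (lapM _ _)).
apply: (etrans (congr2 (fun a b => a * Ddir u (Qf B) + gradB P (Ddir u (Qf B)) *+ 2 + P * b) kP z)).
apply: (etrans (congr1 (fun a => 0 * Ddir u (Qf B) + a *+ 2 + P * 0) e)).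
by rewrite mul0r mulr0 add0r addr0 -mulrnA.
Qed.

Lemma lap_QfM d P : V d P ->
  lap B (Qf B * P) = (6 + 4 * d)%:R *: P + Qf B * lap B P.
Proof.
move/euler_homog.
exact: (alg_lap_formM (@mderivM 3 C) (@mderiv_var R) B_sym B_unit).
Qed.

(** The factor by which the Laplacian maps Q^(k + 1) H to Q^k H, for H harmonic
    of degree m. *)
Definition lap_coef m k : C := (2 * k.+1 * (2 * k + 2 * m + 3))%:R.

Lemma lap_coef_neq0 m k : lap_coef m k != 0.
Proof. by rewrite /lap_coef pnatr_eq0; lia. Qed.

Lemma V_QX d k H : V d H -> V (2 * k + d) (Qf B ^+ k * H).
Proof. by move=> h; apply: (VM _ h); apply/VX/V_Qf. Qed.

Lemma lap_QX m k H : Har B m H ->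
  lap B (Qf B ^+ k.+1 * H) = lap_coef m k *: (Qf B ^+ k * H).
Proof.
move=> [lH hH]; elim: k => [|k IH].
  rewrite expr1 (lap_QfM hH) lH mulr0 addr0 expr0 mul1r; congr (_ *: _).
  by rewrite /lap_coef; congr _%:R; lia.
rewrite exprS -mulrA (lap_QfM (V_QX k.+1 hH)) IH -scalerAr mulrA -exprS.
rewrite -scalerDl; congr (_ *: _); rewrite /lap_coef -natrD; congr _%:R; lia.
Qed.

Lemma lap_Har_QX m k H : Har B m H ->
  lap B (Qf B ^+ k * H) = if k is j.+1 then lap_coef m j *: (Qf B ^+ j * H) else 0.
Proof.
by case: k => [[lH _]|k /lap_QX //]; rewrite expr0 mul1r.
Qed.

Lemma Har0 m : Har B m 0.
Proof. by split; [rewrite /Ker linear0 | exact: V0]. Qed.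

Lemma HarZ m (c : C) H : Har B m H -> Har B m (c *: H).
Proof. by move=> [lH hH]; split; [rewrite /Ker linearZ /= lH scaler0 | exact: VZ]. Qed.

Lemma HarB m H H' : Har B m H -> Har B m H' -> Har B m (H - H').
Proof.
move=> [lH hH] [lH' hH']; split; first by rewrite /Ker linearB /= lH lH' subr0.
by exact: VD hH (VN hH').
Qed.

(** Existence of the decomposition: the Laplacian of P decomposes by induction,
    and by [lap_QX] one can divide the pieces to find a combination with the
    same Laplacian as P. *)
Lemma harmonic_decomposition d P : V d P ->
  exists h : nat -> poly3 R, (forall k, (2 * k <= d)%N -> Har B (d - 2 * k) (h k)) /\
    P = \sum_(k < (d./2).+1) Qf B ^+ k * h k.
Proof.
have [n] := ubnP d; elim: n d P => // n IH d P dn hP.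
have [d2|d2] := ltnP d 2.
  exists (fun k => if k is 0 then P else 0); split.
    case=> [|k] _; last exact: Har0.
    by rewrite muln0 subn0; split; [exact: lap_small hP|].
  by rewrite (_ : d./2 = 0%N) ?big_ord1 ?expr0 ?mul1r; last lia.
case: d d2 dn hP => [//|[//|d]] _ dn hP.
have [|g [hg eg]] := IH d (lap B P) _ (V_lap hP); first by lia.
pose h k := if k is j.+1 then (lap_coef (d - 2 * j) j)^-1 *: g j else 0.
have hh k : (2 * k.+1 <= d.+2)%N -> Har B (d.+2 - 2 * k.+1) (h k.+1).
  move=> kd; have -> : (d.+2 - 2 * k.+1 = d - 2 * k)%N by lia.
  by apply: HarZ; apply: hg; lia.
pose P' := \sum_(k < (d./2).+1) Qf B ^+ k.+1 * h k.+1.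
have lP' : lap B P' = lap B P.
  rewrite eg /P' linear_sum; apply: eq_bigr => k _ /=.
  have kd : (2 * k.+1 <= d.+2)%N by have := ltn_ord k; lia.
  rewrite (lap_QX _ (hh _ kd)) /= -scalerAr scalerA.
  have -> : (d.+2 - 2 * k.+1 = d - 2 * k)%N by lia.
  by rewrite divff ?scale1r // lap_coef_neq0.
exists (fun k => if k is 0 then P - P' else h k); split.
  case=> [|k] kd; last exact: hh.
  rewrite muln0 subn0; split; first by rewrite /Ker linearB /= lP' subrr.
  apply: (VD hP); apply/VN/V_sum => k _.
  have kd' : (2 * k.+1 <= d.+2)%N by have := ltn_ord k; lia.
  have := V_QX k.+1 (hh _ kd').2.
  by have -> : (2 * k.+1 + (d.+2 - 2 * k.+1) = d.+2)%N by lia.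
by rewrite big_ord_recl /= expr0 mul1r subrK.
Qed.

(** Uniqueness of the decomposition: the Laplacian strips one factor of the
    form from each summand. *)
Lemma harmonic_decomposition_inj n d (h : nat -> poly3 R) :
  (forall k, (k < n)%N -> (2 * k <= d)%N /\ Har B (d - 2 * k) (h k)) ->
  \sum_(k < n) Qf B ^+ k * h k = 0 -> forall k, (k < n)%N -> h k = 0.
Proof.
elim: n d h => // n IH d h hh e0.
have hS k : (k < n)%N -> h k.+1 = 0.
  move=> kn; have n0 : (0 < n)%N by lia.
  have d2 : (2 <= d)%N by case: (hh 1%N) => //; lia.
  pose g k := lap_coef (d - 2 * k.+1) k *: h k.+1.
  have /eqP : g k = 0.
    apply: (IH (d - 2)%N g _ _ k kn) => [j jn|].
      have [jd hj] := hh j.+1 jn; split; first lia.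
      have -> : (d - 2 - 2 * j = d - 2 * j.+1)%N by lia.
      exact: (HarZ _ hj).
    have := congr1 (lap B) e0; rewrite linear0 linear_sum big_ord_recl /=.
    have [_ h0] := hh 0%N isT.
    rewrite (lap_Har_QX 0 h0) add0r => e1; rewrite -[RHS]e1.
    apply: eq_bigr => j _; have [_ hj] := hh j.+1 (ltn_ord j : (j.+1 < n.+1)%N).
    by rewrite /= (lap_Har_QX j.+1 hj) /g scalerAr.
  by rewrite /g scaler_eq0 (negPf (lap_coef_neq0 _ _)) => /eqP.
case=> [_|k]; last exact: hS.
move: e0; rewrite big_ord_recl /= expr0 mul1r big1 ?addr0 // => i _.
by rewrite hS ?mulr0.
Qed.

(** Multiplication by Q followed by the Laplacian is a bijection of each space
    of homogeneous polynomials. *)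
Lemma lap_QfM_inj d S : V d S -> lap B (Qf B * S) = 0 -> S = 0.
Proof.
move=> hS l0; have [h [hh eS]] := harmonic_decomposition hS.
have z : forall k, (k < (d./2).+2)%N -> (if k is j.+1 then h j else - (Qf B * S)) = 0.
  apply: (@harmonic_decomposition_inj _ d.+2); last first.
    rewrite big_ord_recl /= expr0 mul1r addrC; apply/eqP; rewrite subr_eq0; apply/eqP.
    by rewrite [in RHS]eS mulr_sumr; apply: eq_bigr => i _; rewrite mulrA -exprS.
  case=> [_|k kd].
    split; first lia.
    rewrite muln0 subn0; split; first by rewrite /Ker linearN /= l0 oppr0.
    exact: (VN (VM V_Qf hS)).
  split; first lia.
  have -> : (d.+2 - 2 * k.+1 = d - 2 * k)%N by lia.
  by apply: hh; lia.
rewrite eS big1 // => k _.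
have /= -> := z k.+1 (ltn_ord k : (k.+1 < (d./2).+2)%N).
by rewrite mulr0.
Qed.

Lemma lap_QfM_surj d M : V d M -> exists2 S, V d S & lap B (Qf B * S) = M.
Proof.
move=> hM; have [h [hh eM]] := harmonic_decomposition hM.
have hk (k : 'I_(d./2).+1) : Har B (d - 2 * k) (h k).
  by apply: hh; have := ltn_ord k; lia.
exists (\sum_(k < (d./2).+1) Qf B ^+ k * ((lap_coef (d - 2 * k) k)^-1 *: h k)).
  apply: V_sum => k _; have := V_QX k (HarZ (lap_coef (d - 2 * k) k)^-1 (hk k)).2.
  by have -> // : (2 * k + (d - 2 * k) = d)%N by have := ltn_ord k; lia.
rewrite mulr_sumr linear_sum eM; apply: eq_bigr => k _ /=.
rewrite mulrA -exprS (lap_QX _ (HarZ _ (hk k))) -scalerAr scalerA.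
by rewrite divff ?scale1r // lap_coef_neq0.
Qed.

End Laplacian.

(** * Linear changes of variables *)

Section Action.
Variable R : realType.
Local Notation C := (Cx R).
Implicit Types (P S : poly3 R).

(** Polynomials are generated by the constants and the variables. *)
Lemma poly3_ind (K : poly3 R -> Prop) :
  (forall c, K (mpolyC 3 c)) -> (forall i, K (var R i)) ->
  (forall P S, K P -> K S -> K (P + S)) ->
  (forall P S, K P -> K S -> K (P * S)) -> forall P, K P.
Proof.
move=> hC hX hD hM; elim/mpolyind => [|c m P _ _ hP].
  by rewrite -(mpolyC0 3 C).
apply: (hD _ _ _ hP); rewrite -mul_mpolyC; apply: (hM); first exact: hC.
rewrite mpolyXE_id; apply: big_ind => [||i _].
- by rewrite -(mpolyC1 3 C).
- exact: (hM).
- elim: (m i) => [|k IH]; first by rewrite expr0 -(mpolyC1 3 C).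
  by rewrite exprS; exact: (hM _ _ (hX i) IH).
Qed.

Implicit Types g h : 'M[C]_3.

(** The tuple of linear forms substituted by [act]. *)
Definition lin_sub g : 3.-tuple (poly3 R) := [tuple \sum_i g i j *: var R i | j < 3].

Lemma actD g : {morph act g : P S / P + S}.
Proof. exact: (comp_mpolyD (lin_sub g)). Qed.

Lemma actZ g c P : act g (c *: P) = c *: act g P.
Proof. exact: (comp_mpolyZ c P (lin_sub g)). Qed.

Lemma act_linear g : linear (act g).
Proof. by move=> c P S; rewrite actD actZ. Qed.
HB.instance Definition _ g :=
  GRing.isLinear.Build C (poly3 R) (poly3 R) _ (act g) (@act_linear g).

Lemma act_monoid g : monoid_morphism (act g).
Proof.
split; first exact: (comp_mpoly_is_multiplicative (lin_sub g)).2.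
exact: (comp_mpoly_is_multiplicative (lin_sub g)).1.
Qed.
HB.instance Definition _ g :=
  GRing.isMonoidMorphism.Build (poly3 R) (poly3 R) (act g) (@act_monoid g).

Lemma actM g : {morph act g : P S / P * S}.
Proof. exact: (act_monoid g).2. Qed.

Lemma actX g P k : act g (P ^+ k) = act g P ^+ k.
Proof. exact: rmorphXn. Qed.

Lemma actC g c : act g (mpolyC 3 c) = mpolyC 3 c.
Proof. exact: comp_mpolyC. Qed.

Lemma act_var g j : act g (var R j) = \sum_i g i j *: var R i.
Proof. by rewrite /act /var comp_mpolyXU -tnth_nth tnth_mktuple. Qed.

Lemma pvalC c v : pval (mpolyC 3 c : poly3 R) v = c.
Proof. exact: mevalC. Qed.

Lemma pval_var i v : pval (var R i) v = v 0 i.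
Proof. exact: mevalXU. Qed.

Lemma pvalD P S v : pval (P + S) v = pval P v + pval S v.
Proof. exact: mevalD. Qed.

Lemma pvalM P S v : pval (P * S) v = pval P v * pval S v.
Proof. exact: mevalM. Qed.

Lemma pvalZ c P v : pval (c *: P) v = c * pval P v.
Proof. exact: mevalZ. Qed.

Lemma pvalB P S v : pval (P - S) v = pval P v - pval S v.
Proof. exact: mevalB. Qed.

Lemma pval0 v : pval (0 : poly3 R) v = 0.
Proof. exact: meval0. Qed.

Lemma pvalX P k v : pval (P ^+ k) v = pval P v ^+ k.
Proof. exact: rmorphXn. Qed.

Lemma pval_sum (I : Type) (r : seq I) (p : pred I) (f : I -> poly3 R) v :
  pval (\sum_(i <- r | p i) f i) v = \sum_(i <- r | p i) pval (f i) v.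
Proof. exact: raddf_sum. Qed.

Lemma pval_act g P v : pval (act g P) v = pval P (v *m g).
Proof.
elim/poly3_ind: P => [c|i|P S hP hS|P S hP hS].
- by rewrite actC !pvalC.
- rewrite act_var pval_sum pval_var mxE; apply: eq_bigr => j _.
  by rewrite pvalZ pval_var mulrC.
- rewrite actD 2!pvalD; exact: (congr2 +%R hP hS).
- rewrite actM 2!pvalM; exact: (congr2 *%R hP hS).
Qed.

Lemma act_comp g h P : act g (act h P) = act (g *m h) P.
Proof.
elim/poly3_ind: P => [c|i|P S hP hS|P S hP hS].
- by rewrite !actC.
- rewrite !act_var linear_sum /=.
  under eq_bigr => j _ do rewrite linearZ /= act_var scaler_sumr.
  rewrite exchange_big; apply: eq_bigr => k _.
  rewrite mxE scaler_suml; apply: eq_bigr => j _.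
  by rewrite scalerA mulrC.
- rewrite 3!actD; exact: (congr2 +%R hP hS).
- rewrite 3!actM; exact: (congr2 *%R hP hS).
Qed.

Lemma act1 P : act 1%:M P = P.
Proof.
elim/poly3_ind: P => [c|i|P S hP hS|P S hP hS].
- by rewrite !actC.
- rewrite act_var (bigD1 i) //= big1 ?addr0 ?mxE ?eqxx ?scale1r //.
  by move=> j /negPf ji; rewrite mxE ji scale0r.
- rewrite actD; exact: (congr2 +%R hP hS).
- rewrite actM; exact: (congr2 *%R hP hS).
Qed.

Lemma actVK g P : g \in unitmx -> act g (act (invmx g) P) = P.
Proof. by move=> gU; rewrite act_comp mulmxV // act1. Qed.

Lemma V_act d g P : V d P -> V d (act g P).
Proof.
move=> /dhomogP hP; rewrite [P]mpolyE linear_sum big_seq /=.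
apply: V_sum => m /hP hm; rewrite linearZ /=; apply: VZ.
have {hm} <- : (\sum_i m i)%N = d by rewrite -mdegE.
rewrite mpolyXE_id rmorph_prod /=.
apply: (big_ind2 (fun (P : poly3 R) k => V k P)) => [|P1 k1 P2 k2|i _].
- exact: dhomog1.
- exact: VM.
- rewrite rmorphXn /= -[X in V X _]mul1n; apply: VX.
  rewrite -/(var R i) act_var; apply: V_sum => j _; apply: VZ; exact: V_var.
Qed.

Lemma mderiv_act g i P :
  mderiv i (act g P) = \sum_k g i k *: act g (mderiv k P).
Proof.
elim/poly3_ind: P => [c|j|P S hP hS|P S hP hS].
- rewrite actC mderivC big1 // => k _.
  by rewrite mderivC linear0 scaler0.
- rewrite act_var linear_sum /=.
  under eq_bigr => k _ do rewrite linearZ /= mderiv_var.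
  under [RHS]eq_bigr => k _ do rewrite mderiv_var rmorph_nat.
  rewrite (bigD1 i) //= big1 ?addr0; last first.
    by move=> k /negPf ki; rewrite ki scaler0.
  rewrite (bigD1 j) //= big1 ?addr0 ?eqxx //.
  by move=> k /negPf kj; rewrite eq_sym kj scaler0.
- rewrite actD mderivD; apply: (etrans (congr2 +%R hP hS)).
  rewrite -big_split; apply: eq_bigr => k _ /=.
  by rewrite mderivD actD scalerDr.
- exact: (alg_chain_mul (@mderivM 3 C) (actM g) hP hS).
Qed.

(** Naturality of the Laplacian: here g B g^T is the matrix of the transformed
    form. *)
Lemma lap_act (B g : 'M[C]_3) P : B \in unitmx -> g \in unitmx ->
  lap (g *m B *m g^T) (act g P) = act g (lap B P).
Proof.
move=> BU gU.
exact: (@alg_lap_chain _ _ (@mderiv 3 C) B BU g (act g) P gU (mderiv_act g)).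
Qed.

Lemma act_Qf (B g : 'M[C]_3) : act g (Qf B) = Qf (g *m B *m g^T).
Proof.
rewrite /Qf linear_sum /=.
under eq_bigr => i _ do rewrite linear_sum /=.
under eq_bigr => i _ do under eq_bigr => j _ do
  rewrite actZ actM !act_var mulr_suml scaler_sumr.
under eq_bigr => i _ do rewrite exchange_big /=.
rewrite exchange_big /=; apply: eq_bigr => k _.
under eq_bigr => i _ do under eq_bigr => j _ do
  rewrite mulr_sumr scaler_sumr.
under eq_bigr => i _ do rewrite exchange_big /=.
rewrite exchange_big /=; apply: eq_bigr => l _.
rewrite mxE scaler_suml exchange_big; apply: eq_bigr => j _ /=.
rewrite !mxE mulr_suml scaler_suml; apply: eq_bigr => i _.
rewrite -scalerAl -scalerAr !scalerA; congr (_ *: _); ring.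
Qed.

Lemma pval_D_D_Qf (M : 'M[C]_3) i j : M^T = M ->
  pval (mderiv j (mderiv i (Qf M))) 0 = M i j *+ 2.
Proof.
move=> hM; have -> : mderiv j (mderiv i (Qf M)) = M i j *: 1 *+ 2.
  exact: (D_D_form (@mderivM 3 C) (@mderiv_var R) hM).
by rewrite mulr2n pvalD pvalZ -(mpolyC1 3 C) pvalC mulr1.
Qed.

(** A quadratic form determines its symmetric matrix: the entries are the second
    derivatives. *)
Lemma Qf_inj (M N : 'M[C]_3) : M^T = M -> N^T = N -> Qf M = Qf N -> M = N.
Proof.
move=> hM hN e; apply/matrixP => i j.
have h := congr1 (fun P => pval (mderiv j (mderiv i P)) 0) e.
move: {h e} (etrans (etrans (esym (pval_D_D_Qf i j hM)) h) (pval_D_D_Qf i j hN)).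
by apply: pmulrnI.
Qed.

Lemma OQ_congr (B g : 'M[C]_3) : B^T = B -> OQ B g -> g *m B *m g^T = B.
Proof.
move=> hB [_ e]; apply: Qf_inj => //; last by rewrite -act_Qf.
by rewrite !trmx_mul trmxK hB mulmxA.
Qed.

Lemma QHar_act (B g : 'M[C]_3) d k P : B^T = B -> B \in unitmx ->
  OQ B g -> QHar B d k P -> QHar B d k (act g P).
Proof.
move=> hB BU hg [H [lH hH] ->]; exists (act g H).
  split; last exact: V_act.
  by rewrite /Ker -{1}(OQ_congr hB hg) lap_act ?lH ?linear0 //; case: hg.
by rewrite actM actX; case: hg => _ ->.
Qed.

End Action.

(** * Congruence of complex symmetric matrices *)

Section Congruence.
Variable F : numClosedFieldType.

(** Polarization: a nonzero symmetric bilinear form has a non-isotropic vector. *)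
Lemma sym_nonisotropic n (B : 'M[F]_n) : B^T = B -> B != 0 ->
  exists u : 'rV[F]_n, (u *m B *m u^T) 0 0 != 0.
Proof.
move=> hB B0; apply: contrapT => h.
have {}h (u : 'rV[F]_n) : (u *m B *m u^T) 0 0 = 0.
  by apply/eqP/negP => /negP ?; apply: h; exists u.
case/negP: B0; apply/eqP/matrixP => i j; rewrite mxE.
pose f (u v : 'rV[F]_n) := (u *m B *m v^T) 0 0.
have fC u v : f u v = f v u.
  by rewrite /f -[in LHS](trmxK (u *m B *m v^T)) mxE !trmx_mul trmxK hB mulmxA.
have fE : f (delta_mx 0 i) (delta_mx 0 j) = B i j.
  by rewrite /f -rowE trmx_delta -colE !mxE.
have : f (delta_mx 0 i + delta_mx 0 j) (delta_mx 0 i + delta_mx 0 j) = 0.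
  exact: h.
have fD u v w : f (u + v) w = f u w + f v w by rewrite /f !mulmxDl mxE.
have f0 u : f u u = 0 by exact: h.
rewrite fD fC fD [X in _ + X]fC fD !f0 add0r addr0 fC -mulr2n fE => /eqP.
by rewrite mulrn_eq0 => /eqP.
Qed.

(** Up to congruence, the upper left entry of B is nonzero. *)
Lemma sym_pivot n (B : 'M[F]_n.+1) : B^T = B -> B != 0 ->
  exists2 G : 'M[F]_n.+1, G \in unitmx & (G *m B *m G^T) 0 0 != 0.
Proof.
move=> hB /(sym_nonisotropic hB) [u hu]; exists (row_ebase u).
  exact: row_ebase_unit.
(* The first row of row_ebase u is proportional to u. *)
apply: contra_neq hu => h0.
have -> : u = (col_ebase u *m pid_mx (\rank u)) 0 (0 : 'I_n.+1) *:
    (delta_mx 0 (0 : 'I_n.+1) *m row_ebase u).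
  rewrite -[LHS]mulmx_ebase scalemxAl; congr (_ *m _).
  apply/rowP => j; rewrite !mxE eqxx /= !big_ord1 !mxE /=.
  case: (eqVneq j 0) => [->|j0] /=; first by rewrite mulr1.
  have /negPf -> : 0%N != j by rewrite eq_sym.
  by rewrite !mulr0.
set c := (_ *m pid_mx _) 0 _; set G := row_ebase u in h0 *.
set w := _ *m G.
have ew : w *m B *m w^T = (\row_j (j == 0)%:R *m (G *m B *m G^T) *m \col_j (j == 0)%:R).
  have -> : \col_(j < n.+1) (j == 0)%:R = (delta_mx 0 0 : 'rV[F]_n.+1)^T.
    by apply/colP => j; rewrite !mxE eqxx.
  have -> : \row_(j < n.+1) (j == 0)%:R = (delta_mx 0 0 : 'rV[F]_n.+1).
    by apply/rowP => j; rewrite !mxE eqxx.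
  by rewrite /w trmx_mul !mulmxA.
have {}ew : (w *m B *m w^T) 0 0 = 0.
  rewrite ew -[RHS]h0 mxE (bigD1 0) //= big1 ?addr0; last first.
    by move=> j /negPf j0; rewrite !mxE j0 mulr0.
  rewrite !mxE eqxx mulr1 (bigD1 0) //= big1 ?addr0; last first.
    by move=> j /negPf j0; rewrite !mxE j0 mul0r.
  by rewrite !mxE eqxx mul1r.
by rewrite -!scalemxAl linearZ /= -scalemxAr mxE [in X in _ * X]mxE ew !mulr0.
Qed.

(** A symmetric matrix over an algebraically closed field factors as A A^T:
    split off a non-isotropic vector and recurse on the Schur complement. *)
Lemma sym_factor n (B : 'M[F]_n) : B^T = B -> exists A : 'M[F]_n, B = A *m A^T.
Proof.
elim: n B => [|n IH] B hB.
  by exists 0; apply/matrixP => -[].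
have [->|B0] := eqVneq B 0; first by exists 0; rewrite mul0mx.
have [G GU hG] := sym_pivot hB B0.
suff [A eA] : exists A : 'M[F]_n.+1, G *m B *m G^T = A *m A^T.
  exists (invmx G *m A); rewrite trmx_mul mulmxA -(mulmxA _ A) -eA.
  by rewrite !mulmxA mulVmx // mul1mx -mulmxA -trmx_mul mulVmx // trmx1 mulmx1.
have : (G *m B *m G^T)^T = G *m B *m G^T.
  by rewrite !trmx_mul trmxK hB mulmxA.
move: (G *m B *m G^T) hG => M; clear B hB B0 G GU => M0 hM.
pose M' : 'M[F]_(1 + n) := M.
have eM : M' = block_mx (M 0 0)%:M (ursubmx M') (ursubmx M')^T (drsubmx M').
  rewrite -[LHS]submxK; congr block_mx.
    by apply/rowP => j; rewrite !ord1 !mxE /=; congr (M _ _); apply: val_inj.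
  by rewrite trmx_ursub; congr dlsubmx; exact: esym.
set b := ursubmx M' in eM; set D := drsubmx M' in eM.
pose s := sqrtC (M 0 0).
have s0 : s != 0 by rewrite sqrtC_eq0.
have sE : s * s = M 0 0 by rewrite -expr2 sqrtCK.
(* The Schur complement of the upper left entry. *)
have [|A' eA'] := IH (D - (M 0 0)^-1 *: (b^T *m b)).
  rewrite linearB linearZ /= trmx_mul trmxK; congr (_ - _).
  rewrite /D trmx_drsub; congr drsubmx; exact: hM.
exists (block_mx s%:M 0 (s^-1 *: b^T) A' : 'M[F]_(1 + n)).
change (M' = block_mx s%:M 0 (s^-1 *: b^T) A' *m (block_mx s%:M 0 (s^-1 *: b^T) A')^T).
rewrite tr_block_mx mulmx_block eM !trmx0 !mulmx0 !mul0mx !addr0 -eA'.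
rewrite tr_scalar_mx linearZ /= trmxK; congr block_mx.
- by rewrite -scalar_mxM sE.
- by rewrite mul_scalar_mx scalerA divff // scale1r.
- by rewrite mul_mx_scalar scalerA divff // scale1r.
- rewrite -scalemxAl -scalemxAr scalerA -invfM sE.
  by rewrite addrC subrK.
Qed.

Lemma sym_congruent n (B B' : 'M[F]_n) : B^T = B -> B \in unitmx ->
  B'^T = B' -> B' \in unitmx ->
  exists2 g : 'M[F]_n, g \in unitmx & B = g *m B' *m g^T.
Proof.
move=> hB BU hB' BU'; have [A eA] := sym_factor hB.
have [A' eA'] := sym_factor hB'.
have AU : A \in unitmx by move: BU; rewrite eA unitmx_mul => /andP[].
have AU' : A' \in unitmx by move: BU'; rewrite eA' unitmx_mul => /andP[].
exists (A *m invmx A'); first by rewrite unitmx_mul AU unitmx_inv.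
rewrite eA eA' trmx_mul !mulmxA mulmxKV // trmx_inv mulmxK //.
by rewrite unitmx_tr.
Qed.

End Congruence.

(** * Polynomials vanishing at all points *)

Section Vanishing.
Variable R : realType.
Local Notation C := (Cx R).
Implicit Types (P S : poly3 R) (u v : 'rV[C]_3).

(** The restriction of a polynomial to the line t |-> v + t u. *)
Definition line v u P : {poly C} :=
  mmap (@polyC C) (fun k => (v 0 k)%:P + u 0 k *: 'X) P.

Lemma lineC v u c : line v u (mpolyC 3 c) = c%:P.
Proof. exact: mmapC. Qed.

Lemma line_var v u i : line v u (var R i) = (v 0 i)%:P + u 0 i *: 'X.
Proof. by rewrite /line /var mmapX mmap1U. Qed.

Lemma lineD v u P S : line v u (P + S) = line v u P + line v u S.
Proof. exact: mmapD. Qed.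

Lemma lineM v u P S : line v u (P * S) = line v u P * line v u S.
Proof. exact: (mmap_is_multiplicative _ _).1. Qed.

Lemma horner_line v u P t : (line v u P).[t] = pval P (v + t *: u).
Proof.
elim/poly3_ind: P => [c|i|P S hP hS|P S hP hS].
- by rewrite lineC hornerC pvalC.
- by rewrite line_var pval_var !mxE !hornerE mulrC.
- by rewrite lineD hornerD pvalD; exact: (congr2 +%R hP hS).
- by rewrite lineM hornerM pvalM; exact: (congr2 *%R hP hS).
Qed.

Lemma Ddir_var u i : Ddir u (var R i) = mpolyC 3 (u 0 i).
Proof.
rewrite /Ddir (bigD1 i) //= big1 ?addr0 => [|j /negPf ji].
  by rewrite mderiv_var eqxx -mul_mpolyC mulr1.
by rewrite mderiv_var eq_sym ji scaler0.
Qed.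

Lemma DdirC u c : Ddir u (mpolyC 3 c) = 0 :> poly3 R.
Proof. by rewrite /Ddir big1 // => i _; rewrite mderivC scaler0. Qed.

Lemma deriv_line v u P : (line v u P)^`() = line v u (Ddir u P).
Proof.
elim/poly3_ind: P => [c|i|P S hP hS|P S hP hS].
- by rewrite lineC derivC DdirC -(mpolyC0 3 C) lineC.
- by rewrite line_var Ddir_var lineC derivD derivZ derivC derivX add0r alg_polyC.
- by rewrite lineD derivD linearD lineD; exact: (congr2 +%R hP hS).
- rewrite lineM derivM DdirM lineD lineM lineM.
  exact: (congr2 (fun a b => a * line v u S + line v u P * b) hP hS).
Qed.

Lemma Ddir_delta i P : Ddir (delta_mx 0 i) P = mderiv i P.
Proof.
rewrite /Ddir (bigD1 i) //= big1 ?addr0; first by rewrite mxE !eqxx scale1r.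
by move=> j /negPf ji; rewrite mxE ji andbF scale0r.
Qed.

Lemma poly_nat_roots (p : {poly C}) : (forall n : nat, p.[n%:R] = 0) -> p = 0.
Proof.
move=> h; apply/eqP/negP => /negP p0.
have := max_poly_roots p0 (rs := [seq i%:R | i <- iota 0 (size p)]).
rewrite size_map size_iota ltnn => H; have {H} : false; last by [].
apply: H; first by apply/allP => _ /mapP[i _ ->]; rewrite /root h.
rewrite map_inj_uniq ?iota_uniq // => i j /eqP.
by rewrite eqr_nat => /eqP.
Qed.

(** A polynomial vanishing at the points with natural coordinates is zero:
    then so are its partial derivatives, and one recurses on the degree. *)
Lemma poly3_nat_eq0 P :
  (forall w : 'I_3 -> nat, pval P (\row_i (w i)%:R) = 0) -> P = 0.
Proof.
have [n hn] : exists n, forall m, (n <= mdeg m)%N -> mcoeff m P = 0.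
  by exists (mmeasure (@mdeg 3) P) => m /mmeasure_mnm_ge /memN_msupp_eq0.
elim: n P hn => [|n IH] P hn hP.
  by apply/mpolyP => m; rewrite mcoeff0 hn.
have D0 i : mderiv i P = 0.
  apply: IH => [m nm|w].
    by rewrite mcoeff_mderiv hn ?mul0rn // mdegD mdeg1 addn1.
  pose v : 'rV[C]_3 := \row_i (w i)%:R.
  suff /(congr1 deriv) : line v (delta_mx 0 i) P = 0.
    rewrite deriv0 deriv_line Ddir_delta => /(congr1 (horner^~ 0)).
    by rewrite horner_line scale0r addr0 horner0.
  apply: poly_nat_roots => k; rewrite horner_line.
  rewrite -[RHS](hP (fun j => w j + (j == i) * k)%N); congr pval.
  apply/rowP => j; rewrite !mxE /= natrD natrM.
  by rewrite mulrC.
have Pc : P = mpolyC 3 (mcoeff mnm0 P).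
  apply/mpolyP => m; rewrite mcoeffC; case: eqVneq => [<-|m0].
    by rewrite mulr1.
  rewrite mulr0; have [i mi] : exists i, m i != 0%N.
    apply: contrapT => h; case/eqP: m0; apply/mnmP => i; rewrite mnm0E.
    by case: (eqVneq (m i) 0%N) => // mi; case: h; exists i.
  have le : lem (mnm1 i) m.
    apply/mnm_lepP => j; rewrite mnm1E; case: eqVneq => [<-|//].
    by rewrite lt0n.
  have /eqP : mcoeff (mnm_sub m (mnm1 i)) (mderiv i P) = 0 by rewrite D0 mcoeff0.
  by rewrite mcoeff_mderiv submK // mulrn_eq0 => /eqP.
have := hP (fun _ => 0%N); rewrite Pc pvalC => ->; exact: mpolyC0.
Qed.

End Vanishing.

(** * Division by the equation of a conic *)

(** Multiplication of elements p0 + y p1 + q s, where q = y^2 - w. *)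
Lemma mul_mod_quadric (A : comPzRingType) (y w p0 p1 s r0 r1 t : A) :
  let q := y * y - w in
  (p0 + y * p1 + q * s) * (r0 + y * r1 + q * t) =
  (p0 * r0 + w * (p1 * r1)) + y * (p0 * r1 + p1 * r0) +
  q * (p1 * r1 + (p0 + y * p1 + q * s) * t + s * (r0 + y * r1)).
Proof. by move=> q; rewrite /q; ring. Qed.

Lemma add_mod_quadric (A : comPzRingType) (y q p0 p1 s r0 r1 t : A) :
  (p0 + y * p1 + q * s) + (r0 + y * r1 + q * t) =
  (p0 + r0) + y * (p1 + r1) + q * (s + t).
Proof. by ring. Qed.

Section ConicForm.
Variable F : numFieldType.

(** The indices of the three coordinates x, y, z. *)
Definition i0 : 'I_3 := @Ordinal 3 0 isT.
Definition i1 : 'I_3 := @Ordinal 3 1 isT.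
Definition i2 : 'I_3 := @Ordinal 3 2 isT.

Lemma sum3 (M : nmodType) (f : 'I_3 -> M) : \sum_i f i = f i0 + f i1 + f i2.
Proof.
rewrite !big_ord_recl big_ord0 addr0 addrA.
by congr (f _ + f _ + f _); apply: val_inj.
Qed.

Lemma ord3P (i : 'I_3) : [\/ i = i0, i = i1 | i = i2].
Proof.
case: i => -[|[|[|//]]] h; [apply: Or31|apply: Or32|apply: Or33]; exact: val_inj.
Qed.

(** The matrix of the form y^2 - x z, whose null cone is parametrized by the
    rational curve (1, t, t^2). *)
Definition conicJ : 'M[F]_3 :=
  \matrix_(i, j) (if (i + j == 2)%N then (if i == j then 1 else - 2^-1) else 0).

Lemma conicJ_sym : conicJ^T = conicJ.
Proof. by apply/matrixP => i j; rewrite !mxE addnC (eq_sym j i). Qed.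

Lemma conicJ_unit : conicJ \in unitmx.
Proof.
pose K : 'M[F]_3 :=
  \matrix_(i, j) (if (i + j == 2)%N then (if i == j then 1 else - 2) else 0).
suff /mulmx1_unit[] : conicJ *m K = 1%:M by [].
have h2 : (2 : F) != 0 by rewrite pnatr_eq0.
apply/matrixP => i j; rewrite mxE sum3 !mxE.
case: (ord3P i) => ->; case: (ord3P j) => -> /=;
  rewrite ?mul0r ?mulr0 ?add0r ?addr0 ?mulr1 //.
- by rewrite mulrNN mulVf.
- by rewrite mulrNN mulVf.
Qed.

Lemma alg_form_conicJ (A : comAlgType F) (x : 'I_3 -> A) :
  alg_form x conicJ = x i1 * x i1 - x i0 * x i2.
Proof.
rewrite /alg_form sum3 !sum3 !mxE /= !scale0r !addr0 !add0r scale1r.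
rewrite (mulrC (x i2)) addrAC addrC; congr (_ + _).
have h : 2^-1 + 2^-1 = 1 :> F by field.
by rewrite -scalerDl -opprD h scaleN1r.
Qed.

End ConicForm.

Section Conic.
Variable R : realType.
Local Notation C := (Cx R).
Implicit Types (P S : poly3 R) (u v : 'rV[C]_3) (c : C).

Local Notation conicJ := (conicJ C).

Lemma Qf_conicJ : Qf conicJ = var R i1 * var R i1 - var R i0 * var R i2.
Proof. exact: alg_form_conicJ. Qed.

Lemma pval_conicJ v : pval (Qf conicJ) v = v 0 i1 ^+ 2 - v 0 i0 * v 0 i2.
Proof. by rewrite Qf_conicJ pvalB !pvalM !pval_var expr2. Qed.

(** Independence of the middle variable. *)
Definition indep_y P := forall v v',
  v 0 i0 = v' 0 i0 -> v 0 i2 = v' 0 i2 -> pval P v = pval P v'.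

Lemma indep_yC c : indep_y (mpolyC 3 c).
Proof. by move=> v v' _ _; rewrite !pvalC. Qed.

Lemma indep_yD P S : indep_y P -> indep_y S -> indep_y (P + S).
Proof.
move=> hP hS v v' e0 e2; rewrite 2!pvalD.
exact: (congr2 +%R (hP _ _ e0 e2) (hS _ _ e0 e2)).
Qed.

Lemma indep_yM P S : indep_y P -> indep_y S -> indep_y (P * S).
Proof.
move=> hP hS v v' e0 e2; rewrite 2!pvalM.
exact: (congr2 *%R (hP _ _ e0 e2) (hS _ _ e0 e2)).
Qed.

(** The value x z + c of y^2 on the surface y^2 - x z = c. *)
Definition xzc c : poly3 R := var R i0 * var R i2 + mpolyC 3 c.

Lemma indep_xzc c : indep_y (xzc c).
Proof.
apply: indep_yD; last exact: indep_yC.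
by apply: indep_yM => v v' e0 e2; rewrite !pval_var.
Qed.

(** Division by the equation y^2 - x z = c, with respect to y. *)
Lemma conic_division c P : exists P0 P1 S, [/\ indep_y P0, indep_y P1 &
  P = P0 + var R i1 * P1 + (var R i1 * var R i1 - xzc c) * S].
Proof.
elim/poly3_ind: P => [a|i|P S [P0 [P1 [P2 [h0 h1 e]]]] [S0 [S1 [S2 [g0 g1 f]]]]
  |P S [P0 [P1 [P2 [h0 h1 e]]]] [S0 [S1 [S2 [g0 g1 f]]]]].
- exists (mpolyC 3 a), 0, 0; split; [exact: indep_yC| |].
    by rewrite -(mpolyC0 3 C); exact: indep_yC.
  by rewrite !mulr0 !addr0.
- case: (ord3P i) => ->.
  + exists (var R i0), 0, 0; split.
    * by move=> v v' e0 e2; rewrite !pval_var.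
    * by rewrite -(mpolyC0 3 C); exact: indep_yC.
    * by rewrite !mulr0 !addr0.
  + exists 0, 1, 0; split.
    * by rewrite -(mpolyC0 3 C); exact: indep_yC.
    * by rewrite -(mpolyC1 3 C); exact: indep_yC.
    * by rewrite mulr0 mulr1 addr0 add0r.
  + exists (var R i2), 0, 0; split.
    * by move=> v v' e0 e2; rewrite !pval_var.
    * by rewrite -(mpolyC0 3 C); exact: indep_yC.
    * by rewrite !mulr0 !addr0.
- exists (P0 + S0), (P1 + S1), (P2 + S2); split; try exact: indep_yD.
  exact: (etrans (congr2 +%R e f) (add_mod_quadric _ _ _ _ _ _ _ _)).
- eexists; eexists; eexists; split; last first.
  + exact: (etrans (congr2 *%R e f) (mul_mod_quadric _ _ _ _ _ _ _ _)).
  + by apply: indep_yD; exact: indep_yM.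
  + apply: indep_yD; first exact: indep_yM.
    apply: indep_yM; [exact: indep_xzc | exact: indep_yM].
Qed.

(** A polynomial vanishing at the points with x <> 0 of the conic surface
    y^2 - x z = c is a multiple of its equation. *)
Lemma conic_null c P :
  (forall v, v 0 i0 != 0 -> pval (Qf conicJ) v = c -> pval P v = 0) ->
  exists S, P = (Qf conicJ - mpolyC 3 c) * S.
Proof.
move=> hP; have [P0 [P1 [S [h0 h1 eP]]]] := conic_division c P.
have var0_neq0 : var R i0 != 0.
  apply/eqP => /(congr1 (fun P => pval P (const_mx 1))).
  by rewrite pval_var pval0 mxE => /eqP; rewrite oner_eq0.
(* Above a point (x, z) the surface has the two points y and - y, with
   y^2 = x z + c; adding and subtracting the two values of P isolates P0 and
   y P1, and y (y P1) = (x z + c) P1. *)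
have main v : v 0 i0 != 0 ->
    pval P0 v = 0 /\ (v 0 i0 * v 0 i2 + c) * pval P1 v = 0.
  move=> x0; pose a := v 0 i0 * v 0 i2 + c.
  pose w (y : C) : 'rV[C]_3 := \row_i (if i == i1 then y else v 0 i).
  have ev y : y ^+ 2 = a -> pval P0 v + y * pval P1 v = 0.
    move=> ya; have w0 : w y 0 i0 = v 0 i0 by rewrite mxE.
    have w2 : w y 0 i2 = v 0 i2 by rewrite mxE.
    have w1 : w y 0 i1 = y by rewrite mxE.
    have qa : pval (var R i1 * var R i1 - xzc c) (w y) = 0.
      rewrite pvalB pvalM pval_var w1 -expr2 ya pvalD pvalM 2!pval_var pvalC.
      by rewrite w0 w2 subrr.
    have := hP (w y); rewrite w0 => /(_ x0).
    rewrite pval_conicJ w0 w1 w2 ya /a addrAC subrr add0r => /(_ erefl).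
    rewrite eP pvalD (pvalM (_ - _)) qa mul0r addr0 pvalD pvalM pval_var w1.
    by rewrite (h0 _ v w0 w2) (h1 _ v w0 w2).
  have s2 : sqrtC a ^+ 2 = a by exact: sqrtCK.
  have e1 := ev _ s2.
  have e2 : pval P0 v - sqrtC a * pval P1 v = 0.
    by rewrite -mulNr; apply: ev; rewrite sqrrN.
  have z0 : pval P0 v = 0.
    have : pval P0 v *+ 2 = 0.
      by rewrite mulr2n -[RHS](addr0 0) -{1}e1 -e2 addrACA subrr addr0.
    by move/eqP; rewrite mulrn_eq0 => /eqP.
  split; first exact: z0.
  move: e1; rewrite z0 add0r => e1.
  by rewrite -/a -s2 expr2 -mulrA e1 mulr0.
have z0 : P0 = 0.
  have /eqP : var R i0 * P0 = 0.
    apply: poly3_nat_eq0 => w; rewrite pvalM pval_var.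
    set v := (\row_i _ : 'rV[C]_3).
    have [->|x0] := eqVneq (v 0 i0) 0; first by rewrite mul0r.
    by case: (main v x0) => -> _; rewrite mulr0.
  by rewrite mulf_eq0 (negPf var0_neq0) => /eqP.
have z1 : P1 = 0.
  have /eqP : var R i0 * (xzc c * P1) = 0.
    apply: poly3_nat_eq0 => w; rewrite pvalM pval_var pvalM pvalD pvalM.
    rewrite 2!pval_var pvalC; set v := (\row_i _ : 'rV[C]_3).
    have [->|x0] := eqVneq (v 0 i0) 0; first by rewrite mul0r.
    by case: (main v x0) => _ ->; rewrite mulr0.
  rewrite mulf_eq0 (negPf var0_neq0) /= mulf_eq0 => /orP[|/eqP //].
  move/eqP/(congr1 (fun P => pval P (\row_i (if i == i0 then 1 else 1 - c)))).
  rewrite pvalD pvalM 2!pval_var pvalC pval0 !mxE /= mul1r subrK => /eqP.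
  by rewrite oner_eq0.
exists S; rewrite eP z0 z1 mulr0 !add0r Qf_conicJ; congr (_ * _).
by rewrite /xzc opprD addrA.
Qed.

End Conic.

(** * The Dirichlet problem *)

Lemma linear_subZ (A : pzRingType) (U W : lmodType A) (h : {linear U -> W}) a b c :
  h b = 0 -> h (a - c *: b) = h a.
Proof. by move=> hb; rewrite linearB linearZ /= hb scaler0 subr0. Qed.

Section Dirichlet.
Variable R : realType.
Local Notation C := (Cx R).
Implicit Types (P S F : poly3 R) (v : 'rV[C]_3) (c : C) (d n : nat).

Lemma deg_le0 d : deg_le d (0 : poly3 R).
Proof. by rewrite /deg_le mmeasure0. Qed.

Lemma deg_leD d P S : deg_le d P -> deg_le d S -> deg_le d (P + S).
Proof.
move=> hP hS; apply: (leq_trans (mmeasureD_le _ P S)).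
by rewrite geq_max; apply/andP; split.
Qed.

Lemma deg_le_ex P : exists d, deg_le d P.
Proof. by exists (mmeasure (@mdeg 3) P); exact: leqnSn. Qed.

Lemma V_deg_le i d P : (i <= d)%N -> V i P -> deg_le d P.
Proof.
move=> id /dhomogP hP; rewrite /deg_le mmeasureE.
by apply/bigmax_leqP_seq => m /hP -> _.
Qed.

(** The homogeneous component of degree d. *)
Notation hom d P := (pihomog (@mdeg 3) d P).

Lemma V_hom d P : V d (hom d P).
Proof. exact: pihomogP. Qed.

Lemma hom_sum d P : deg_le d P -> P = \sum_(i < d.+1) hom i P.
Proof. exact: pihomog_partitionE. Qed.

Lemma hom_V d P : V d P -> hom d P = P.
Proof. exact: pihomog_dE. Qed.

Lemma hom_V_neq d e P : V d P -> d != e -> hom e P = 0.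
Proof. by move=> hP de; exact: (pihomog_ne0 de hP). Qed.

Lemma homogeneous_sum_eq0 n (f : nat -> poly3 R) :
  (forall i, (i < n)%N -> V i (f i)) -> \sum_(i < n) f i = 0 ->
  forall i, (i < n)%N -> f i = 0.
Proof.
move=> hf e i lin; have := congr1 (fun P => hom i P) e.
rewrite linear_sum linear0 (bigD1 (Ordinal lin)) //= big1 ?addr0.
  by move=> h; rewrite -(hom_V (hf i lin)).
move=> j ji; apply: (hom_V_neq (hf j (ltn_ord j))).
by apply: contra ji => /eqP e'; apply/eqP/val_inj.
Qed.

Variable B : 'M[C]_3.
(** The homogeneous components of a harmonic polynomial are harmonic. *)
Lemma Ker_hom d P : Ker B P -> deg_le d P -> forall i, Har B i (hom i P).
Proof.
move=> kP dP i; split; last exact: V_hom.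
have [id|di] := leqP i d; last first.
  suff -> : hom i P = 0 by exact: linear0.
  rewrite (hom_sum dP) linear_sum big1 // => j _.
  apply: (hom_V_neq (V_hom j P)); have := ltn_ord j; lia.
have [i2|i2] := ltnP i 2; first exact: (lap_small B i2 (V_hom i P)).
pose f j := lap B (hom j.+2 P).
have hf j : (j < d.-1)%N -> V j (f j) by move=> _; exact: (V_lap B (V_hom _ P)).
have : \sum_(j < d.-1) f j = 0.
  have := kP; rewrite /Ker {1}(hom_sum dP) linear_sum /=.
  case: d id {hf dP} => [|[|d]] id; [lia|lia|].
  rewrite 2!big_ord_recl /= => h; rewrite -[RHS]h.
  rewrite (lap_small B (isT : (0 < 2)%N) (V_hom 0 P)).
  by rewrite (lap_small B (isT : (1 < 2)%N) (V_hom 1 P)) !add0r.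
move/(homogeneous_sum_eq0 hf)/(_ (i - 2)%N); rewrite /f.
have -> : (i - 2).+2 = i by lia.
by apply; lia.
Qed.

Hypotheses (B_sym : B^T = B) (B_unit : B \in unitmx).

(** Harmonic polynomials of the form (Q - c) S vanish: the top homogeneous
    component T of S would satisfy the Laplace equation for Q T. *)
Lemma lap_QfcM_sum_inj c n (f : nat -> poly3 R) : (forall i, V i (f i)) ->
  lap B ((Qf B - mpolyC 3 c) * \sum_(i < n) f i) = 0 -> \sum_(i < n) f i = 0.
Proof.
move=> hf; elim: n => [|n IH]; first by rewrite big_ord0.
suff fn : lap B ((Qf B - mpolyC 3 c) * \sum_(i < n.+1) f i) = 0 -> f n = 0.
  move=> h; have e : \sum_(i < n.+1) f i = \sum_(i < n) f i.
    rewrite big_ord_recr /=.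
    exact: (etrans (congr2 +%R (erefl _) (fn h)) (addr0 _)).
  by apply: (etrans e); apply: IH; rewrite -[X in _ * X]e.
have vQ i : V i (lap B (Qf B * f i)) := V_lap B (VM (V_Qf B) (hf i)).
(* In degree n, only the Laplacian of Q f_n contributes. *)
have low i : (i <= n)%N -> hom n (lap B (f i)) = 0.
  move=> lin; have [i2|i2] := ltnP i 2.
    rewrite (lap_small B i2 (hf i)); exact: linear0.
  have hi : V (i - 2).+2 (f i) by have -> : (i - 2).+2 = i by lia.
  by apply: (hom_V_neq (V_lap B hi)); lia.
pose t i := lap B ((Qf B - mpolyC 3 c) * f i).
have et i : t i = lap B (Qf B * f i) - c *: lap B (f i).
  by rewrite /t mulrBl linearB /= mul_mpolyC linearZ.
have ht i : (i <= n)%N -> hom n (t i) = hom n (lap B (Qf B * f i)).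
  move=> lin; rewrite et.
  exact: (@linear_subZ _ _ _ (@pihomog 3 C (@mdeg 3) n) _ _ c (low i lin)).
have -> : lap B ((Qf B - mpolyC 3 c) * \sum_(i < n.+1) f i) = \sum_(i < n.+1) t i.
  by rewrite mulr_sumr; exact: linear_sum.
move/(congr1 (fun P => hom n P)).
have -> : hom n (\sum_(i < n.+1) t i) = \sum_(i < n.+1) hom n (t i) by exact: linear_sum.
rewrite big_ord_recr /= big1 => [|i _]; last first.
  rewrite (ht i (ltnW (ltn_ord i))); apply: (hom_V_neq (vQ i)).
  by have := ltn_ord i; lia.
rewrite add0r (ht n (leqnn n)) (hom_V (vQ n)) => h.
exact: (lap_QfM_inj B_sym B_unit (hf n) (etrans h (linear0 _))).
Qed.

Lemma lap_QfcM_inj c S : lap B ((Qf B - mpolyC 3 c) * S) = 0 -> S = 0.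
Proof.
have [d dS] := deg_le_ex S.
rewrite (hom_sum dS); exact: (@lap_QfcM_sum_inj c d.+1 (fun i => hom i S) (V_hom^~ S)).
Qed.

(** A polynomial vanishing on the surface Q = c is a multiple of Q - c. *)
Lemma surface_null c P : (forall v, surface B c v -> pval P v = 0) ->
  exists S, P = (Qf B - mpolyC 3 c) * S.
Proof.
move=> hP.
have [g gU eB] := sym_congruent B_sym B_unit (conicJ_sym C) (conicJ_unit C).
have [|S eS] := @conic_null _ c (act (invmx g) P).
  move=> v _ vc; rewrite pval_act; apply: hP.
  by rewrite /surface /= eB -act_Qf pval_act mulmxKV.
exists (act g S); rewrite -(actVK P gU) eS actM; congr (_ * _).
by rewrite linearB /= actC act_Qf -eB.
Qed.

(** Uniqueness in the Dirichlet problem. *)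
Lemma Ker_surface_inj c P : Ker B P ->
  (forall v, surface B c v -> pval P v = 0) -> P = 0.
Proof.
move=> kP /surface_null[S eS].
by move: kP; rewrite /Ker eS => /lap_QfcM_inj ->; rewrite mulr0.
Qed.

Lemma KerD P S : Ker B P -> Ker B S -> Ker B (P + S).
Proof.
move=> kP kS; apply: (etrans (linearD (lap B) P S)).
exact: (etrans (congr2 +%R kP kS) (addr0 0)).
Qed.

(** Replacing each Q^k H by c^k H in the harmonic decomposition gives a
    harmonic polynomial with the same restriction to the surface Q = c. *)
Lemma harmonic_restriction c d F : deg_le d F ->
  exists P, [/\ Ker B P, deg_le d P &
    forall v, surface B c v -> pval P v = pval F v].
Proof.
move=> dF; rewrite (hom_sum dF).
pose K F := exists P, [/\ Ker B P, deg_le d P &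
    forall v, surface B c v -> pval P v = pval F v].
have KD F1 F2 : K F1 -> K F2 -> K (F1 + F2).
  move=> [P1 [k1 d1 e1]] [P2 [k2 d2 e2]]; exists (P1 + P2); split.
  - exact: KerD.
  - exact: deg_leD.
  - by move=> v vc; rewrite 2!pvalD; exact: (congr2 +%R (e1 v vc) (e2 v vc)).
have K0 : K 0.
  by exists 0; split => //; [exact: linear0 | exact: deg_le0].
rewrite -/(K _); apply: (big_ind K) => [//|//|i _].
have [h [hh ->]] := harmonic_decomposition B_sym B_unit (V_hom i F).
apply: (big_ind K) => [//|//|k _]; exists (c ^+ k *: h k).
have [|lh vh] := hh k; first by have := ltn_ord k; lia.
have id := ltn_ord i; split.
- by rewrite /Ker linearZ /= lh scaler0.
- by apply: (V_deg_le _ (VZ (c ^+ k) vh)); lia.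
- by move=> v vc; rewrite pvalZ pvalM pvalX vc.
Qed.

Lemma lap_surj (M : poly3 R) : exists P, lap B P = M.
Proof.
have [d dM] := deg_le_ex M.
rewrite (hom_sum dM).
apply: (big_ind (fun M => exists P, lap B P = M)) => [|M1 M2 [P1 <-] [P2 <-]|i _].
- by exists 0; exact: linear0.
- by exists (P1 + P2); exact: linearD.
- have [S _ e] := lap_QfM_surj B_sym B_unit (V_hom i M).
  by exists (Qf B * S).
Qed.

Lemma dirichlet c (M N : poly3 R) :
  exists! P, lap B P = M /\ (forall v, surface B c v -> pval P v = pval N v).
Proof.
(* A particular solution P0, corrected by the harmonic polynomial H with the
   boundary values of N - P0. *)
have [P0 e0] := lap_surj M.
have [d dF] := deg_le_ex (N - P0).
have [H [kH _ eH]] := harmonic_restriction c dF.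
have e1 : lap B (P0 + H) = M.
  exact: (etrans (linearD (lap B) P0 H) (etrans (congr2 +%R e0 kH) (addr0 M))).
exists (P0 + H); split.
  split=> [|v vc]; first exact: e1.
  by rewrite pvalD (eH v vc) pvalB addrC subrK.
move=> P [lP eP]; apply/eqP; rewrite -subr_eq0; apply/eqP.
apply: (@Ker_surface_inj c) => [|v vc].
  apply: (etrans (linearB (lap B) (P0 + H) P)).
  exact: (etrans (congr2 (fun a b => a - b) e1 lP) (subrr M)).
by rewrite pvalB pvalD (eH v vc) (eP v vc) pvalB (addrC (pval P0 v)) subrK subrr.
Qed.

End Dirichlet.

(** * Maxwell polynomials and Sylvester's theorem *)

Lemma homogeneous_coord (F : fieldType) (x z : F) : x != 0 ->
  z = x * (x * z / x ^+ 2).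
Proof. by move=> x0; field. Qed.

Section Factorization.
Variable F : closedFieldType.
Implicit Types (p q : {poly F}).

Lemma poly_quadratic_factor n p : (size p <= n.+3)%N ->
  exists q s, [/\ p = q * s, (size q <= 3)%N & (size s <= n.+1)%N].
Proof.
have lin k (r : {poly F}) : (size r <= k.+2)%N ->
    exists l t, [/\ r = l * t, (size l <= 2)%N & (size t <= k.+1)%N].
  move=> hr; have [s1|s1] := leqP (size r) 1.
    by exists 1, r; rewrite mul1r size_poly1; split=> //; apply: leq_trans s1 _.
  have /closed_rootP[x] : size r != 1%N by rewrite neq_ltn s1 orbT.
  rewrite root_factor_theorem => /dvdpP[t et].
  exists ('X - x%:P), t; split; [by rewrite mulrC | by rewrite size_XsubC |].
  move: hr; rewrite et size_Mmonic ?monicXsubC //; last first.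
    by apply: contraTneq s1 => t0; rewrite et t0 mul0r size_poly0.
  by rewrite size_XsubC addn2.
move=> /lin[l [t [-> hl /lin[l' [t' [-> hl' ht']]]]]].
exists (l * l'), t'; split; [by rewrite mulrA | | exact: ht'].
apply: leq_trans (size_polyMleq _ _) _; lia.
Qed.

(** Over an algebraically closed field, a polynomial of degree at most 2m is a
    product of m polynomials of degree at most 2, for m > 0. *)
Lemma poly_quadratic_prod m p : (size p <= (2 * m.+1).+1)%N ->
  exists qs : seq {poly F},
    [/\ size qs = m.+1, all (fun q => size q <= 3)%N qs & p = \prod_(q <- qs) q].
Proof.
elim: m p => [|m IH] p hp.
  by exists [:: p]; rewrite /= big_seq1 hp.
have [|q [s [-> hq hs]]] := @poly_quadratic_factor (2 * m.+1) p.
  by rewrite (leq_trans hp) //; lia.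
have [qs [sz hqs ->]] := IH s hs.
by exists (q :: qs); rewrite /= big_cons sz hq.
Qed.

End Factorization.

Section Maxwell.
Variable R : realType.
Local Notation C := (Cx R).
Implicit Types (P S H : poly3 R) (u a v : 'rV[C]_3) (c : C) (d m : nat).

(** The restriction of a polynomial to the rational curve (1, t, t^2): the i-th
    variable, counted from 0, is replaced by the i-th power of t. *)
Definition curve P : {poly C} := mmap (@polyC C) (fun i : 'I_3 => 'X^i) P.

Lemma horner_curve P t : (curve P).[t] = pval P (\row_i t ^+ i).
Proof.
elim/poly3_ind: P => [c|i|P S hP hS|P S hP hS].
- by rewrite /curve mmapC hornerC pvalC.
- by rewrite /curve /var mmapX mmap1U hornerXn -/(var R i) pval_var mxE.
- by rewrite /curve mmapD hornerD pvalD; exact: (congr2 +%R hP hS).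
- rewrite /curve (mmap_is_multiplicative _ _).1 hornerM pvalM.
  exact: (congr2 *%R hP hS).
Qed.

Lemma size_curve m P : V m P -> (size (curve P) <= (2 * m).+1)%N.
Proof.
move=> /dhomogP hP; rewrite /curve /mmap.
apply: (leq_trans (size_sum _ _ _)); apply/bigmax_leqP_seq => w /hP hw _.
apply: (leq_trans (size_polyMleq _ _)).
have -> : mmap1 (fun i : 'I_3 => 'X^i : {poly C}) w = 'X^(\sum_(i < 3) i * w i).
  rewrite /mmap1; apply: (big_ind2 (fun (p : {poly C}) k => p = 'X^k)) => //.
  - by move=> p1 k1 p2 k2 -> ->; rewrite -exprD.
  - by move=> i _; rewrite -exprM.
have {}hw : m = (\sum_i w i)%N by rewrite -mdegE.
have le : (\sum_(i < 3) i * w i <= 2 * m)%N.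
  rewrite hw big_distrr /=; apply: leq_sum => i _.
  by rewrite leq_mul2r; apply/orP; right; have := ltn_ord i; lia.
rewrite size_polyXn addnS /= -(addn1 (2 * m)) addnC.
by apply: leq_add; [exact: le | exact: size_polyC_leq1].
Qed.

Lemma pval_homog m P c v : V m P -> pval P (c *: v) = c ^+ m * pval P v.
Proof.
move=> /dhomogP hP; rewrite /pval !mevalE mulr_sumr.
apply: eq_big_seq => w /hP hw.
have {}hw : m = (\sum_i w i)%N by rewrite -mdegE.
rewrite mulrCA; congr (_ * _); rewrite hw -prodrXr -big_split /=.
by apply: eq_bigr => i _; rewrite mxE exprMn.
Qed.

(** The linear form with coefficients a. *)
Definition linform a : poly3 R := \sum_i a 0 i *: var R i.

Lemma V_linform a : V 1 (linform a).
Proof. by apply: V_sum => i _; apply: VZ; exact: V_var. Qed.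

Lemma V_prod_linform (s : seq 'rV[C]_3) : V (size s) (\prod_(a <- s) linform a).
Proof.
elim: s => [|a s IH]; first by rewrite big_nil; exact: dhomog1.
rewrite big_cons; exact: (VM (V_linform a) IH).
Qed.

Lemma act_linform (g : 'M[C]_3) a : act g (linform a) = linform (a *m g^T).
Proof.
rewrite /linform linear_sum /=.
under eq_bigr => i _ do rewrite linearZ /= act_var scaler_sumr.
rewrite exchange_big; apply: eq_bigr => j _ /=.
rewrite mxE scaler_suml; apply: eq_bigr => i _.
by rewrite scalerA mxE.
Qed.

Lemma act_prod_linform (g : 'M[C]_3) (s : seq 'rV[C]_3) :
  act g (\prod_(a <- s) linform a) = \prod_(a <- [seq b *m g^T | b <- s]) linform a.
Proof.
elim: s => [|a s IH]; first by rewrite !big_nil; exact: (act_monoid g).1.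
rewrite /= 2!big_cons actM; exact: (congr2 *%R (act_linform g a) IH).
Qed.

(** On the null cone, a homogeneous polynomial of positive degree is a product
    of linear forms: this is the factorization of its restriction to the
    curve (1, t, t^2). *)
Lemma conic_linear_factors m P : V m.+1 P ->
  exists s : seq 'rV[C]_3, size s = m.+1 /\
    exists S, P = \prod_(a <- s) linform a + Qf (conicJ C) * S.
Proof.
move=> hP; have [qs [sz hqs eqs]] := poly_quadratic_prod (size_curve hP).
pose row (q : {poly C}) : 'rV[C]_3 := \row_i q`_i.
exists [seq row q | q <- qs]; split; first by rewrite size_map.
set L := \prod_(a <- _) _.
have VL : V m.+1 L by rewrite -sz -(size_map row qs); exact: V_prod_linform.
have curveL t : pval L (\row_i t ^+ i) = pval P (\row_i t ^+ i).
  rewrite -[RHS]horner_curve eqs /L big_map; clear L VL eqs.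
  elim: qs hqs {sz} => [|q qs IH] /=.
    by rewrite !big_nil -(mpolyC1 3 C) pvalC hornerC.
  move=> /andP[hq /IH{}IH]; rewrite 2!big_cons pvalM hornerM.
  apply: (congr2 *%R _ IH); rewrite pval_sum (horner_coef_wide _ hq).
  by apply: eq_bigr => i _; rewrite pvalZ pval_var !mxE.
have hG : V m.+1 (P - L) by apply: (VD hP); exact: VN.
(* P - L vanishes on the curve, hence by homogeneity on the cone off x = 0. *)
have [|S eS] := @conic_null _ 0 (P - L).
  move=> v x0; rewrite pval_conicJ => e.
  have -> : v = v 0 i0 *: (\row_(i < 3) (v 0 i1 / v 0 i0) ^+ i).
    apply/rowP => i; rewrite !mxE; case: (ord3P i) => -> /=.
    - by rewrite expr0 mulr1.
    - by rewrite expr1 mulrC divfK.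
    - rewrite expr_div_n (subr0_eq e); exact: homogeneous_coord.
  by rewrite (pval_homog _ _ hG) pvalB curveL subrr mulr0.
exists S; move: eS; rewrite mpolyC0 subr0 => <-.
by rewrite addrC subrK.
Qed.

Variable B : 'M[C]_3.
Hypotheses (B_sym : B^T = B) (B_unit : B \in unitmx).

Lemma cone_linear_factors m P : V m.+1 P ->
  exists s : seq 'rV[C]_3, size s = m.+1 /\
    exists S, P = \prod_(a <- s) linform a + Qf B * S.
Proof.
move=> hP.
have [g gU eB] := sym_congruent B_sym B_unit (conicJ_sym C) (conicJ_unit C).
have [s [sz [S eS]]] := conic_linear_factors (V_act (invmx g) hP).
exists [seq b *m g^T | b <- s]; split; first by rewrite size_map.
exists (act g S); rewrite -(actVK P gU) eS actD actM act_Qf -eB.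
by rewrite act_prod_linform.
Qed.

(** The polynomial Q^(m + 1/2) D_u1 ... D_um Q^(-1/2), where m is the number of
    vectors. *)
Fixpoint maxwell_poly (us : seq 'rV[C]_3) : poly3 R :=
  if us is u :: us' then
    Qf B * Ddir u (maxwell_poly us') -
    ((size us')%:R + 2^-1) *: (maxwell_poly us' * Ddir u (Qf B))
  else 1.

Lemma maxwell_poly_cons u us : maxwell_poly (u :: us) =
  Qf B * Ddir u (maxwell_poly us) -
  ((size us)%:R + 2^-1) *: (maxwell_poly us * Ddir u (Qf B)).
Proof. by []. Qed.

Lemma V_maxwell_poly us : V (size us) (maxwell_poly us).
Proof.
elim: us => [|u us IH]; first exact: dhomog1.
apply: VD.
  have [sz|nsz] := posnP (size us).
    have h : V 0 (maxwell_poly us) by move: IH; rewrite sz.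
    rewrite (Ddir_V0 u h) mulr0; exact: V0.
  have h : V (size us).-1.+1 (maxwell_poly us) by rewrite prednK.
  have := VM (V_Qf B) (V_Ddir u h).
  by have -> : (2 + (size us).-1)%N = (size us).+1 by lia.
apply/VN/VZ; have := VM IH (@V_Ddir R 1 u _ (V_Qf B)).
by rewrite addn1.
Qed.

Lemma Ker_maxwell_poly us : Ker B (maxwell_poly us).
Proof.
elim: us => [|u us IH].
  by apply: (@lap_small _ _ 0 _ isT); exact: dhomog1.
rewrite /Ker maxwell_poly_cons; set W := maxwell_poly us in IH *.
have hW : V (size us) W := V_maxwell_poly us.
have e1 : lap B (Qf B * Ddir u W) = (4 * size us + 2)%:R *: Ddir u W.
  have [sz|nsz] := posnP (size us).
    have h : V 0 W by move: hW; rewrite sz.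
    by rewrite (Ddir_V0 u h) mulr0 linear0 scaler0.
  have h : V (size us).-1.+1 W by rewrite prednK.
  apply: (etrans (lap_QfM B_sym B_unit (V_Ddir u h))).
  have -> : lap B (Ddir u W) = 0.
    by rewrite -Ddir_lap (_ : lap B W = 0) ?linear0.
  by rewrite mulr0 addr0; congr (_%:R *: _); lia.
have e2 := lap_Ddir_QfM B_sym B_unit u IH.
set k : C := _ + 2^-1.
apply: (etrans (linearB (lap B) _ _)).
have e3 : lap B (k *: (W * Ddir u (Qf B))) = k *: (Ddir u W *+ 4).
  by rewrite linearZ /=; exact: (congr1 (fun b => k *: b) e2).
apply: (etrans (congr2 (fun a b : poly3 R => a - b) e1 e3)); rewrite /k.
rewrite -(scaler_nat 4) scalerA -scalerBl -[RHS](scale0r (Ddir u W)); congr (_ *: _).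
by rewrite natrD natrM; field.
Qed.

Lemma Ddir_Qf u : Ddir u (Qf B) = linform (u *m B) *+ 2.
Proof.
rewrite /Ddir.
under eq_bigr => i _ do rewrite (mderiv_Qf B_sym) -scalerMnr scaler_sumr.
rewrite sumrMnl exchange_big; congr (_ *+ 2); apply: eq_bigr => j _.
rewrite mxE scaler_suml; apply: eq_bigr => i _.
by rewrite scalerA.
Qed.

(** Modulo Q, the polynomial above is a product of linear forms, which are
    arbitrary. *)
Lemma maxwell_poly_mod (s : seq 'rV[C]_3) :
  exists us, size us = size s /\
    exists S, maxwell_poly us = \prod_(a <- s) linform a + Qf B * S.
Proof.
elim: s => [|a s [us [sz [S eS]]]].
  by exists [::]; split=> //; exists 0; rewrite big_nil mulr0 addr0.
(* The derivative of Q along u is 2 (u B) . v, which the scalar k and the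
   inverse of B normalize to the prescribed linear form. *)
pose k : C := ((size us)%:R + 2^-1) *+ 2.
have k0 : k != 0.
  rewrite mulrn_eq0 /=; apply: lt0r_neq0.
  by apply: ltr_wpDl; rewrite ?ler0n // invr_gt0 ltr0n.
pose u := - k^-1 *: (a *m invmx B).
exists (u :: us); split; first by rewrite /= sz.
have eu : - ((size us)%:R + 2^-1) *: Ddir u (Qf B) = linform a.
  rewrite Ddir_Qf -scalerMnr scalerMnl mulNrn -/k.
  rewrite /u -scalemxAl mulmxKV // /linform scaler_sumr; apply: eq_bigr => i _.
  by rewrite mxE scalerA mulrA mulrNN divff // mul1r.
exists (Ddir u (maxwell_poly us) + S * linform a).
rewrite [LHS]/= big_cons -scaleNr scalerAr eu eS.
by rewrite mulrDl mulrDr addrCA mulrC -!mulrA; congr (_ + _).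
Qed.

(** Sylvester's theorem: harmonic polynomials of positive degree m are
    given by m vectors. Indeed such a polynomial is determined by its restriction to the
    null cone. *)
Lemma harmonic_maxwell_poly m P : Har B m.+1 P ->
  exists us, size us = m.+1 /\ P = maxwell_poly us.
Proof.
move=> [kP hP]; have [s [sz [S eS]]] := cone_linear_factors hP.
have [us [szu [T eT]]] := maxwell_poly_mod s.
exists us; split; first by rewrite szu.
have e : P - maxwell_poly us = (Qf B - mpolyC 3 0) * (S - T).
  by rewrite eS eT mpolyC0 subr0 mulrBr opprD addrACA subrr add0r.
have k : lap B ((Qf B - mpolyC 3 0) * (S - T)) = 0.
  rewrite -e; apply: (etrans (linearB (lap B) _ _)).
  exact: (etrans (congr2 (fun a b : poly3 R => a - b) kP (Ker_maxwell_poly us)) (subrr 0)).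
apply/eqP; rewrite -subr_eq0; apply/eqP.
by rewrite e (lap_QfcM_inj B_sym B_unit k) mulr0.
Qed.

End Maxwell.

(** * Differentiation of branches of the square root *)

Section Branch.
Variables (K : numFieldType) (V : normedModType K).
Implicit Types (u v : V).

Lemma cvg_segment u v : (fun h : K => h *: u + v) @ 0^' --> v.
Proof.
have c : (fun h : K => h *: u + v) @ (0 : K) --> 0 *: u + v.
  apply: (@cvgD K V K (nbhs (0 : K)) _ (fun h => h *: u) (fun=> v)); last exact: cvg_cst.
  exact: (@cvgZr_tmp K V K (nbhs (0 : K)) _ id).
by have /continuous_withinNx := c; rewrite scale0r add0r.
Qed.

(** A continuous branch of the square root of q is differentiable where q is,
    off its zeroes. *)
Lemma is_derive_sqrt_branch (U : set V) (q s : V -> K) u v dq :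
  open U -> U v -> (forall w, U w -> s w ^+ 2 = q w) ->
  {for v, continuous s} -> s v != 0 -> is_derive v u q dq ->
  is_derive v u s (dq / (2 * s v)).
Proof.
move=> Uo Uv sq cs s0 [exq <-].
(* (s w - s v) = (q w - q v) / (s w + s v) where the sum is nonzero. *)
pose g (h : K) := (h^-1 *: (q (h *: u + v) - q v)) * (s (h *: u + v) + s v)^-1.
have ss : (fun h : K => s (h *: u + v)) @ 0^' --> s v.
  apply: (@cvg_comp _ _ _ (fun h : K => h *: u + v) s _ (nbhs v)); last exact: cs.
  exact: cvg_segment.
have s20 : s v + s v != 0 by rewrite -mulr2n mulrn_eq0.
have sss : (fun h : K => s (h *: u + v) + s v) @ 0^' --> s v + s v.
  by apply: cvgD => //; exact: cvg_cst.
have gc : g @ 0^' --> 'D_u q v / (2 * s v).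
  apply: cvgM; first exact: exq.
  by rewrite mulr_natl mulr2n; exact: cvgV.
have gs : (fun h : K => h^-1 *: ((s \o shift v) (h *: u) - s v)) @ 0^'
    --> 'D_u q v / (2 * s v).
  have nU : \forall h \near (0 : K)^', U (h *: u + v).
    have := @cvg_segment u v U. apply. exact: open_nbhs_nbhs.
  have nn : \forall h \near (0 : K)^', s (h *: u + v) + s v != 0.
    apply: (sss [set x | x != 0]); exists `|s v + s v|; first by rewrite /= normr_gt0.
    move=> y /= yl; apply/eqP => y0.
    by move: yl; rewrite y0 subr0 ltxx.
  apply: cvg_trans gc; apply: near_eq_cvg; near=> h.
  have Uh : U (h *: u + v) by near: h.
  have nz : s (h *: u + v) + s v != 0 by near: h.
  by rewrite /g /= -(sq _ Uh) -(sq _ Uv) subr_sqr -scalerAl mulfK.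
apply: DeriveDef; first by apply/cvg_ex; eexists; exact: gs.
exact: cvg_lim gs.
Unshelve. all: by end_near. Qed.

End Branch.

(** The identity behind the recursive definition of [maxwell_poly], with
    s ^ (2 m) = t. *)
Lemma maxwell_step (F : numFieldType) (s t m w dw dq : F) : s != 0 -> t != 0 ->
  w * (- (s * t) ^- 2 * ((2 * m + 1) * t * (dq / (2 * s)))) + (s * t)^-1 * dw =
  (s ^+ 2 * dw - (m + 2^-1) * (w * dq)) / (s * (s * (s * t))).
Proof. by move=> s0 t0; field; rewrite s0 t0. Qed.

Lemma map_nth_pred (T : Type) (x0 : T) (s : seq T) :
  [seq nth x0 s j.-1 | j <- iota 1 (size s)] = s.
Proof.
rewrite -[RHS](mkseq_nth x0) /mkseq -(addn0 1%N) iotaDl -map_comp.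
by apply: eq_map => j.
Qed.

Section MaxwellBranch.
Variable R : realType.
Local Notation C := (Cx R).
Implicit Types (P S H : poly3 R) (u v : 'rV[C]_3) (us : seq 'rV[C]_3) (d m : nat).

Lemma is_derive_congr (f g : 'rV[C]_3 -> C) u v (a b : C) :
  f = g -> a = b -> is_derive v u f a -> is_derive v u g b.
Proof. by move=> -> ->. Qed.

Lemma is_derive_coord i u v :
  is_derive v u (fun w : 'rV[C]_3 => w 0 i : C) (u 0 i).
Proof.
have h : (fun h : C => h^-1 *: (((fun w : 'rV[C]_3 => w 0 i : C) \o shift v) (h *: u)
    - v 0 i)) @ 0^' --> u 0 i.
  have c : (fun _ : C => u 0 i : C) @ (0 : C)^' --> u 0 i by exact: cvg_cst.
  apply: cvg_trans c; apply: near_eq_cvg; near=> h.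
  have h0 : h != 0 by near: h; exact: nbhs_dnbhs_neq.
  by rewrite /= !mxE addrK scalerA mulVf // scale1r.
apply: DeriveDef; first by apply/cvg_ex; eexists; exact: h.
exact: cvg_lim h.
Unshelve. all: by end_near. Qed.

Lemma is_derive_pval u v P : is_derive v u (pval P) (pval (Ddir u P) v).
Proof.
elim/poly3_ind: P => [c|i|P S hP hS|P S hP hS].
- rewrite DdirC pval0 (_ : pval _ = cst c); first exact: is_derive_cst.
  by apply/funext => w; rewrite pvalC.
- rewrite Ddir_var pvalC (_ : pval _ = fun w => w 0 i); first exact: is_derive_coord.
  by apply/funext => w; rewrite pval_var.
- apply: (is_derive_congr _ _ (is_deriveD hP hS)).
    by apply/funext => w; exact: esym (pvalD P S w).
  have e : Ddir u (P + S) = Ddir u P + Ddir u S by exact: linearD.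
  by rewrite e; exact: esym (pvalD _ _ v).
- apply: (is_derive_congr _ _ (is_deriveM hP hS)).
    by apply/funext => w; exact: esym (pvalM P S w).
  rewrite DdirM pvalD addrC; apply: (congr2 +%R).
    by apply: (etrans (mulrC _ _)); exact: esym (pvalM _ _ v).
  exact: esym (pvalM _ _ v).
Qed.

Variables (B : 'M[C]_3) (U : set 'rV[C]_3) (s : 'rV[C]_3 -> C).
Hypothesis branch : sqrt_branch B U s.

Lemma is_derive_branch u v : U v ->
  is_derive v u s (pval (Ddir u (Qf B)) v / (2 * s v)).
Proof.
move=> Uv; have [Uo hs] := branch; have [cs s0 _] := hs v Uv.
apply: (is_derive_sqrt_branch Uo Uv _ cs s0 (is_derive_pval u v (Qf B))).
by move=> w /hs[].
Qed.

(** On the domain of the branch s of Q^(1/2), the iterated derivative of Q^(-1/2)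
    is the polynomial [maxwell_poly] divided by s^(2 m + 1). *)
Lemma nabla_branch us v : U v ->
  nabla us (fun w => (s w)^-1) v =
  pval (maxwell_poly B us) v / s v ^+ (2 * size us).+1.
Proof.
elim: us v => [|u us IH] v Uv /=.
  by rewrite -(mpolyC1 3 C) pvalC mul1r.
have [Uo hs] := branch; have [cs s0 sq] := hs v Uv.
set W := maxwell_poly B us in IH *; set k := (2 * size us).+1 in IH.
(* The induction hypothesis holds near v, since U is open. *)
have near_eq : \near v, nabla us (fun w => (s w)^-1) v = (pval W * (fun w => (s w ^+ k)^-1)) v.
  have : \near v, U v by exact: open_nbhs_nbhs.
  by apply: filterS => w Uw; rewrite (IH w Uw).
rewrite (near_eq_derive _ near_eq).
have sk0 : s v ^+ k != 0 by rewrite expf_neq0.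
have dX : is_derive v u (fun w => s w ^+ k)
    ((k%:R * s v ^+ k.-1) *: (pval (Ddir u (Qf B)) v / (2 * s v))).
  apply: (is_derive_congr _ erefl (is_deriveX k (is_derive_branch u Uv))).
  by apply/funext => w; rewrite exprfctE.
have [exX valX] := dX.
have dV : is_derive v u (fun w => (s w ^+ k)^-1)
    (- (s v ^+ k) ^- 2 *: ((k%:R * s v ^+ k.-1) *:
      (pval (Ddir u (Qf B)) v / (2 * s v)))).
  apply: DeriveDef; first exact: (@derivableV C _ (fun w => s w ^+ k) v u sk0 exX).
  exact: (etrans (@deriveV C _ (fun w => s w ^+ k) v u sk0 exX)
    (congr1 (fun a => - (s v ^+ k) ^- 2 *: a) valX)).
have [_ ->] := is_deriveM (is_derive_pval u v W) dV.
rewrite pvalB pvalM pvalZ pvalM -sq.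
have -> : (2 * (size us).+1).+1 = (2 * size us).+3 by lia.
rewrite /k /= (_ : s v ^+ (2 * size us).+3 =
  s v * (s v * (s v * s v ^+ (2 * size us)))); last by rewrite !exprS.
rewrite (exprS (s v) (2 * size us)).
have kR : (2 * size us).+1%:R = 2 * (size us)%:R + 1 :> C by rewrite -addn1 natrD natrM.
rewrite kR; move: (s v ^+ (2 * size us)) (expf_neq0 (2 * size us) s0) => t t0.
exact: maxwell_step.
Qed.

(** The vectors are indexed from 1, hence the predecessor below. *)
Lemma maxwell_term_branch us lam e v : U v -> (size us <= e)%N ->
  maxwell_term s lam e (size us) (fun j => nth 0 us j.-1) v =
  (if size us == 0%N then lam else 1) *
  pval (Qf B ^+ (e - size us) * maxwell_poly B us) v.
Proof.
move=> Uv le; rewrite /maxwell_term.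
rewrite map_nth_pred.
have [_ hs] := branch; have [_ s0 sq] := hs v Uv.
rewrite (nabla_branch us Uv) pvalM pvalX -sq -mulrA; congr (_ * _).
have -> : (2 * e).+1 = (2 * (e - size us) + (2 * size us).+1)%N by lia.
rewrite exprD exprM mulrCA -mulrA divff ?mulr1 1?mulrC //.
by rewrite expf_neq0.
Qed.

End MaxwellBranch.

Section MaxwellRepresentation.
Variable R : realType.
Local Notation C := (Cx R).
Implicit Types (P S H : poly3 R) (u v : 'rV[C]_3) (us : seq 'rV[C]_3) (d m : nat).
Variable B : 'M[C]_3.
Hypotheses (B_sym : B^T = B) (B_unit : B \in unitmx).

(** A sum of products of powers of Q and harmonic polynomials has a Maxwell
    representation, provided that at most one of the latter has degree 0. *)
Lemma maxwell_rep_sum d n (m : nat -> nat) k0 (H : nat -> poly3 R) P :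
  (forall k, (k < n)%N -> [/\ (m k <= d - k)%N, Har B (m k) (H k) &
     m k = 0%N -> k = k0]) ->
  P = \sum_(0 <= k < n) Qf B ^+ (d - k - m k) * H k ->
  maxwell_rep B d n m P.
Proof.
move=> hH eP.
have ex k : exists us, (k < n)%N -> [/\ size us = m k &
    (0 < m k)%N -> H k = maxwell_poly B us].
  have [kn|kn] := ltnP k n; last by exists [::].
  have [_ hk _] := hH k kn; have [m0|m0] := posnP (m k).
    by exists [::]; rewrite m0.
  have hk' : Har B (m k).-1.+1 (H k) by rewrite prednK.
  have [us [sz e]] := harmonic_maxwell_poly B_sym B_unit hk'.
  by exists us => _; rewrite sz prednK.
have [us hus] := choice ex.
exists (pval (H k0) 0), (fun j k => nth 0 (us k) j.-1) => U s branch v Uv.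
rewrite eP pval_sum; apply: eq_big_nat => k kn.
have [sz e] := hus k kn; have [le [_ hk] z] := hH k kn.
rewrite -sz (maxwell_term_branch branch) ?sz //.
rewrite 2!pvalM.
have [m0|m0] := posnP (m k).
  have us0 : us k = [::] by apply: size0nil; rewrite sz.
  (* A polynomial of degree 0 equals its value at the origin. *)
  rewrite us0 /= -(mpolyC1 3 C) pvalC mulr1 mulrC; congr (_ * _).
  rewrite -(z m0); have hk0 : V 0 (H k) by move: hk; rewrite m0.
  by have := pval_homog 0 v hk0; rewrite scale0r expr0 mul1r.
rewrite mul1r; apply: (congr2 *%R (erefl _)); by rewrite (e m0).
Qed.

Lemma maxwell_rep_Ker d P : Ker B P -> deg_le d P ->
  maxwell_rep B d d.+1 (fun k => d - k)%N P.
Proof.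
move=> kP dP.
apply: (@maxwell_rep_sum _ _ _ d (fun k => pihomog (@mdeg 3) (d - k) P)).
  by move=> k kn; split; [exact: leqnn | exact: (Ker_hom kP dP) | lia].
rewrite {1}(hom_sum dP) -(big_mkord predT (fun i => pihomog (@mdeg 3) i P)).
rewrite big_nat_rev; apply: eq_big_nat => k kn.
by rewrite add0n subSS subnn expr0 mul1r.
Qed.

Lemma maxwell_rep_homog d P : V d P ->
  maxwell_rep B d (d./2).+1 (fun k => d - 2 * k)%N P.
Proof.
move=> hP; have [h [hh eP]] := harmonic_decomposition B_sym B_unit hP.
apply: (@maxwell_rep_sum _ _ _ d./2 h).
  move=> k kn; split; [lia | apply: hh; lia | lia].
rewrite eP -(big_mkord predT (fun k => Qf B ^+ k * h k)).
apply: eq_big_nat => k kn; congr (_ ^+ _ * _); lia.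
Qed.

End MaxwellRepresentation.

(** * Integrals of trigonometric monomials *)

Section SegmentIntegrals.
Variable R : realType.
Notation mu := (@lebesgue_measure R).
Implicit Types (f g : R -> R) (a b x : R).

Lemma continuous_integrable f a b : continuous f ->
  mu.-integrable `[a, b] (EFin \o f).
Proof.
move=> cf; apply: continuous_compact_integrable; first exact: segment_compact.
exact: continuous_subspaceT.
Qed.

Lemma continuous_sum (I : Type) (s : seq I) (c : I -> R) (f : I -> R -> R) :
  (forall i, continuous (f i)) -> continuous (fun x => \sum_(i <- s) c i * f i x).
Proof.
move=> cf; elim: s => [|i t IH] x.
  under eq_fun => y do rewrite big_nil; exact: cvg_cst.
under eq_fun => y do rewrite big_cons.
apply: cvgD; last exact: IH.
by apply: cvgM; [exact: cvg_cst | exact: cf].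
Qed.

Lemma Rintegral_sum (I : Type) (s : seq I) (c : I -> R) (f : I -> R -> R) a b :
  (forall i, continuous (f i)) ->
  (\int[mu]_(x in `[a, b]) (\sum_(i <- s) c i * f i x) =
   \sum_(i <- s) c i * \int[mu]_(x in `[a, b]) f i x)%R.
Proof.
move=> cf; elim: s => [|i s IH].
  rewrite big_nil; under eq_Rintegral => x _ do rewrite big_nil.
  by rewrite Rintegral_cst // mul0r.
rewrite big_cons -IH; under eq_Rintegral => x _ do rewrite big_cons.
have ci : continuous (fun x => c i * f i x).
  by move=> x; apply: cvgM; [exact: cvg_cst | exact: cf].
rewrite RintegralD //; last 2 first.
- exact: continuous_integrable.
- exact/continuous_integrable/continuous_sum.
by rewrite RintegralZl //; exact: continuous_integrable.
Qed.

(** Integral of a derivative over a segment. *)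
Lemma Rintegral_derive f F a b : a < b -> continuous f ->
  (forall x, is_derive x (1 : R) F (f x)) ->
  (\int[mu]_(x in `[a, b]) f x = F b - F a)%R.
Proof.
move=> ab cf dF.
have cF : continuous F.
  move=> x; apply: differentiable_continuous; apply/derivable1_diffP.
  by have [] := dF x.
rewrite /Rintegral (@continuous_FTC2 _ f F) //.
- exact: continuous_subspaceT.
- split.
  + by move=> x _; have [] := dF x.
  + exact: cvg_at_right_filter (cF a).
  + exact: cvg_at_left_filter (cF b).
- by move=> x _; rewrite derive1E; have [_ ->] := dF x.
Qed.

(** A continuous nonnegative function with zero integral over a segment
    vanishes inside the segment. *)
Lemma Rintegral_eq0 f a b : continuous f ->
  (forall x, a <= x <= b -> 0 <= f x) ->
  (\int[mu]_(x in `[a, b]) f x = 0)%R ->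
  forall x, a < x < b -> f x = 0.
Proof.
move=> cf f0 If x /andP[ax xb].
apply/eqP; rewrite eq_le f0 ?(ltW ax) ?(ltW xb) // andbT leNgt; apply/negP => fx.
(* If f x > 0, then f > e on a segment [c, c'] around x. *)
pose e := f x / 2.
have e0 : 0 < e by rewrite divr_gt0.
have [d d0 hd] : exists2 d, 0 < d & forall y, `|x - y| < d -> e < f y.
  have : \forall y \near x, e < f y.
    apply: (cf x [set z | e < z]); apply: open_nbhs_nbhs; split; first exact: open_gt.
    by rewrite /= /e ltr_pdivrMr // ltr_pMr // ltr1n.
  by move=> /nbhs_ballP[d d0 hd]; exists d => // y xy; exact: hd.
pose c := Num.max a (x - d / 2); pose c' := Num.min b (x + d / 2).
have d20 : 0 < d / 2 by rewrite divr_gt0.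
have cx : c < x by rewrite /c gt_max ax ltrBlDr ltrDl.
have xc : x < c' by rewrite /c' lt_min xb ltrDl.
have sub : `[c, c'] `<=` `[a, b].
  by apply: subset_itv; rewrite bnd_simp /c /c' ?le_max ?ge_min lexx.
have /integrableP[mf _] := @continuous_integrable f a b cf.
have I0 : (\int[mu]_(y in `[a, b]) (f y)%:E)%E = 0%E.
  rewrite -[LHS]fineK; first by rewrite -[fine _]/(Rintegral _ _ _) If.
  apply: integrable_fin_num => //; exact: (@continuous_integrable f a b cf).
have : (\int[mu]_(y in `[c, c']) e%:E <= 0)%E.
  rewrite -I0; apply: (@le_trans _ _ (\int[mu]_(y in `[c, c']) (f y)%:E)%E).
    apply: ge0_le_integral => //.
    - by move=> y _; rewrite lee_fin ltW.
    - by apply: measurable_funS mf.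
    - move=> y; rewrite /= in_itv /= /c /c' => /andP[].
      rewrite ge_max le_min => /andP[_ h1] /andP[_ h2].
      rewrite lee_fin ltW // hd // ltr_norml.
      by apply/andP; split; lra.
  by apply: ge0_subset_integral.
rewrite integral_cst //= lebesgue_measure_itv /= lte_fin (lt_trans cx xc).
rewrite -EFinB -EFinM lee_fin leNgt => /negP; apply.
by rewrite mulr_gt0 // subr_gt0 (lt_trans cx xc).
Qed.

End SegmentIntegrals.

Section TrigMoments.
Variable R : realType.
Notation mu := (@lebesgue_measure R).
Implicit Types (a b x : R) (p q : nat).

(** The trigonometric monomial sin^p cos^q and its integral over [0, b]. *)
Definition trig p q x : R := sin x ^+ p * cos x ^+ q.

Lemma continuous_trig p q : continuous (trig p q).
Proof.
move=> x; apply: cvgM.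
  by apply: (@continuous_comp _ _ _ sin (fun y => y ^+ p));
    [exact: continuous_sin | exact: exprn_continuous].
by apply: (@continuous_comp _ _ _ cos (fun y => y ^+ q));
  [exact: continuous_cos | exact: exprn_continuous].
Qed.

Definition trig_int b p q : R := (\int[mu]_(x in `[0, b]) trig p q x)%R.

Lemma is_derive_trig p q x : is_derive x (1 : R) (trig p q)
  (p%:R * trig p.-1 q.+1 x - q%:R * trig p.+1 q.-1 x).
Proof.
have ds := is_deriveX p (is_derive_sin x).
have dc := is_deriveX q (is_derive_cos x).
have -> : trig p q = (sin ^+ p) * (cos ^+ q).
  by apply/funext => y; rewrite mulrfctE !exprfctE.
apply: is_derive_eq (is_deriveM ds dc) _.
rewrite /trig !exprfctE !exprS /=.
rewrite /GRing.scale /=.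
set S := sin x ^+ p; set S' := sin x ^+ p.-1.
set K := cos x ^+ q; set K' := cos x ^+ q.-1.
ring.
Qed.

(** Integration by parts, when sin^p cos^q takes the same value at 0 and b. The
    predecessors are harmless: a zero exponent comes with a zero factor. *)
Lemma trig_int_parts b p q : 0 < b -> trig p q b = trig p q 0 ->
  p%:R * trig_int b p.-1 q.+1 = q%:R * trig_int b p.+1 q.-1.
Proof.
move=> b0 e.
have c1 p' q' (k : R) : continuous (fun x => k * trig p' q' x).
  by move=> x; apply: cvgM; [exact: cvg_cst | exact: continuous_trig].
have cd : continuous (fun x => p%:R * trig p.-1 q.+1 x - q%:R * trig p.+1 q.-1 x).
  by move=> x; apply: cvgB; exact: c1.
have := Rintegral_derive b0 cd (is_derive_trig p q).
rewrite e subrr RintegralB //; [|exact: continuous_integrable|exact: continuous_integrable].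
rewrite !RintegralZl //; last 2 first.
- exact: continuous_integrable (@continuous_trig _ _).
- exact: continuous_integrable (@continuous_trig _ _).
by move/eqP; rewrite subr_eq0 => /eqP.
Qed.

Lemma trig_int_pythagoras b p q :
  trig_int b p q.+2 = trig_int b p q - trig_int b p.+2 q.
Proof.
rewrite /trig_int -RintegralB //; last 2 first.
- exact: continuous_integrable (@continuous_trig _ _).
- exact: continuous_integrable (@continuous_trig _ _).
apply: eq_Rintegral => x _; rewrite /trig.
have := cos2Dsin2 x => h; rewrite !exprSr -!mulrA -!expr2.
have -> : cos x ^+ 2 = 1 - sin x ^+ 2 by rewrite -h addrK.
ring.
Qed.

(** The integrals over the ranges of the polar angle theta and of the azimuth
    phi. *)
Definition theta_int := trig_int pi.
Definition phi_int := trig_int (2 * pi).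

Lemma theta_int_parts p q :
  p.+1%:R * theta_int p q.+1 = q%:R * theta_int p.+2 q.-1.
Proof.
apply: (@trig_int_parts pi p.+1 q); first exact: pi_gt0.
by rewrite /trig sinpi sin0 !expr0n /= !mul0r.
Qed.

Lemma phi_int_parts p q :
  p%:R * phi_int p.-1 q.+1 = q%:R * phi_int p.+1 q.-1.
Proof.
apply: trig_int_parts; first by rewrite mulr_gt0 // pi_gt0.
by rewrite /trig mulr_natl sin2pi cos2pi sin0 cos0.
Qed.

Lemma phi_int_sin p q : (q + p + 1)%:R * phi_int p.+1 q = p%:R * phi_int p.-1 q.
Proof.
have := phi_int_parts p q.+1; rewrite /= .
case: p => [|p]; first by rewrite !mul0r addn0 -addn1 => <-.
rewrite /= /phi_int trig_int_pythagoras mulrBr => /eqP.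
rewrite subr_eq -mulrDl -natrD => /eqP ->; congr (_%:R * _); lia.
Qed.

Lemma phi_int_cos p q : (q + p + 1)%:R * phi_int p q.+1 = q%:R * phi_int p q.-1.
Proof.
have := phi_int_parts p.+1 q; rewrite /=.
case: q => [|q]; first by rewrite !mul0r add0n addn1.
have e := trig_int_pythagoras (2 * pi) p q.
rewrite /= /phi_int => h.
have e' : trig_int (2 * pi) p.+2 q = trig_int (2 * pi) p q - trig_int (2 * pi) p q.+2.
  by rewrite e opprB addrCA subrr addr0.
move: h; rewrite e' mulrBr => /eqP; rewrite -subr_eq0 opprB addrA subr_eq0 -mulrDl -natrD.
by move=> /eqP <-; congr (_%:R * _); lia.
Qed.

(** The integral over the sphere of x^a y^b z^c, in spherical coordinates; the
    additional factor sin theta comes from the surface measure. *)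
Definition moment (a b c : nat) : R := theta_int (a + b).+1 c * phi_int b a.

(** The three recurrences below express the invariance of the integral under
    infinitesimal rotations of the coordinate planes. *)
Lemma moment_xy (a b c : nat) :
  b%:R * moment a.+1 b.-1 c = a%:R * moment a.-1 b.+1 c.
Proof.
rewrite /moment !(mulrCA _ (theta_int _ _)) phi_int_parts.
case: a => [|a]; first by rewrite !mul0r !mulr0.
case: b => [|b].
  have := phi_int_parts 0 a.+1; rewrite mul0r /= => <-.
  by rewrite !mulr0.
by congr (theta_int _ _ * _); lia.
Qed.

Lemma moment_yz (a b c : nat) :
  c%:R * moment a b.+1 c.-1 = b%:R * moment a b.-1 c.+1.
Proof.
rewrite /moment addnS mulrA -theta_int_parts mulrAC.
have -> : (a + b).+1%:R * phi_int b.+1 a = b%:R * phi_int b.-1 a.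
  by rewrite -phi_int_sin addn1.
case: b => [|b]; first by rewrite !mul0r.
by rewrite /= addnS -mulrA; congr (_ * _); rewrite mulrC.
Qed.

Lemma moment_xz (a b c : nat) :
  c%:R * moment a.+1 b c.-1 = a%:R * moment a.-1 b c.+1.
Proof.
rewrite /moment addSn mulrA -theta_int_parts mulrAC.
have -> : (a + b).+1%:R * phi_int b a.+1 = a%:R * phi_int b a.-1.
  by rewrite -phi_int_cos addn1.
case: a => [|a]; first by rewrite !mul0r.
by rewrite /= addSn -mulrA; congr (_ * _); rewrite mulrC.
Qed.

End TrigMoments.

(** * The integral over the sphere as a functional on polynomials *)

Section SphereFunctional.
Variable R : realType.
Local Notation C := (Cx R).
Implicit Types (P S : poly3 R) (w : multinom 3) (u : 'rV[R]_3).

(** The embedding of the real numbers, with values in the type [Cx R]. *)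
Definition cplx (r : R) : C := real_complex R r.

Lemma cplxM x y : cplx (x * y) = cplx x * cplx y.
Proof. exact: rmorphM. Qed.

Lemma cplxX x n : cplx (x ^+ n) = cplx x ^+ n.
Proof. exact: rmorphXn. Qed.

Lemma cplx_nat n : cplx n%:R = n%:R.
Proof. exact: rmorph_nat. Qed.

(** A real point seen in complex space. *)
Definition real_row u : 'rV[C]_3 := map_mx (real_complex R) u.

(** The value of a monomial at a real point. *)
Definition monom_val w u : R := u 0 i0 ^+ w i0 * u 0 i1 ^+ w i1 * u 0 i2 ^+ w i2.

Lemma prod3 (A : comPzSemiRingType) (f : 'I_3 -> A) :
  \prod_i f i = f i0 * f i1 * f i2.
Proof.
rewrite !big_ord_recl big_ord0 mulr1 mulrA.
by congr (f _ * f _ * f _); apply: val_inj.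
Qed.

Lemma pval_real_row P u :
  pval P (real_row u) = \sum_(w <- msupp P) mcoeff w P * cplx (monom_val w u).
Proof.
rewrite /pval mevalE; apply: eq_bigr => w _; congr (_ * _).
rewrite prod3 /monom_val !cplxM !cplxX; congr (_ ^+ _ * _ ^+ _ * _ ^+ _);
  by rewrite mxE.
Qed.

Lemma Re_sum (I : Type) (s : seq I) (c : I -> C) (r : I -> R) :
  complex.Re (\sum_(i <- s) c i * cplx (r i)) = \sum_(i <- s) complex.Re (c i) * r i.
Proof.
elim: s => [|i s IH]; first by rewrite !big_nil.
rewrite !big_cons -IH; case: (\sum_(_ <- _) _) => a b; case: (c i) => a' b' /=.
by rewrite mulr0 subr0.
Qed.

Lemma Im_sum (I : Type) (s : seq I) (c : I -> C) (r : I -> R) :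
  complex.Im (\sum_(i <- s) c i * cplx (r i)) = \sum_(i <- s) complex.Im (c i) * r i.
Proof.
elim: s => [|i s IH]; first by rewrite !big_nil.
rewrite !big_cons -IH; case: (\sum_(_ <- _) _) => a b; case: (c i) => a' b' /=.
by rewrite mulr0 add0r.
Qed.

(** The integral over the sphere of the monomial with exponents w. *)
Definition mom w : R := moment R (w i0) (w i1) (w i2).

Lemma monom_val_sphere w theta phi : monom_val w (sphere_point theta phi) =
  trig (w i0 + w i1) (w i2) theta * trig (w i1) (w i0) phi.
Proof. by rewrite /monom_val /trig !mxE /= !exprMn exprD; ring. Qed.

Lemma inner_Rint (s : seq (multinom 3)) (c : multinom 3 -> R) theta :
  (\int[lebesgue_measure]_(phi in `[0%R, (2 * pi)%R])
    (\sum_(w <- s) c w * monom_val w (sphere_point theta phi)))%R =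
  \sum_(w <- s) c w * phi_int R (w i1) (w i0) * trig (w i0 + w i1) (w i2) theta.
Proof.
under eq_Rintegral => phi _.
  under eq_bigr => w _ do rewrite monom_val_sphere mulrA.
  over.
rewrite (Rintegral_sum s (fun w => c w * trig (w i0 + w i1) (w i2) theta)).
  by apply: eq_bigr => w _; rewrite mulrAC.
by move=> w; exact: continuous_trig.
Qed.

Lemma sphere_Rint_sum (s : seq (multinom 3)) (c : multinom 3 -> R) :
  sphere_Rint (fun u => \sum_(w <- s) c w * monom_val w u) = \sum_(w <- s) c w * mom w.
Proof.
rewrite /sphere_Rint.
transitivity (\int[lebesgue_measure]_(theta in `[0%R, pi%R]) (\sum_(w <- s)
    c w * phi_int R (w i1) (w i0) * trig (w i0 + w i1).+1 (w i2) theta))%R.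
  apply: eq_Rintegral => theta _; rewrite inner_Rint mulr_suml.
  by apply: eq_bigr => w _; rewrite /trig exprS; ring.
rewrite Rintegral_sum; last by move=> w; exact: continuous_trig.
by apply: eq_bigr => w _; rewrite /mom /moment -mulrA (mulrC (phi_int _ _ _)).
Qed.

(** The integral of a polynomial over the unit sphere, defined on coefficients so
    that linearity is plain; see [sphere_int_pval]. *)
Definition sphere_mom P : C := \sum_(w <- msupp P) mcoeff w P * cplx (mom w).

Lemma sphere_int_pval P : sphere_int (fun u => pval P (real_row u)) = sphere_mom P.
Proof.
rewrite /sphere_int /sphere_mom; apply/eqP; rewrite eq_complex.
rewrite [complex.Re (Complex _ _)]/= [complex.Im (Complex _ _)]/=.
rewrite Re_sum Im_sum -!sphere_Rint_sum; apply/andP; split; apply/eqP.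
  by congr sphere_Rint; apply/funext => u; rewrite pval_real_row Re_sum.
by congr sphere_Rint; apply/funext => u; rewrite pval_real_row Im_sum.
Qed.

Lemma sphere_mom_seq (s : seq (multinom 3)) P : uniq s -> {subset msupp P <= s} ->
  sphere_mom P = \sum_(w <- s) mcoeff w P * cplx (mom w).
Proof.
move=> us sub; rewrite [RHS](bigID (mem (msupp P))) /= [X in _ + X]big1 ?addr0.
  rewrite -[RHS]big_filter; apply: perm_big; apply: uniq_perm.
  - exact: msupp_uniq.
  - exact: filter_uniq.
  - move=> w; rewrite mem_filter /=; case: (boolP (w \in msupp P)) => //= h.
    by rewrite sub.
by move=> w /memN_msupp_eq0 ->; rewrite mul0r.
Qed.

Lemma sphere_mom_linear : scalar sphere_mom.
Proof.
move=> c P S; pose s := undup (msupp P ++ msupp S ++ msupp (c *: P + S)).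
have us : uniq s := undup_uniq _.
rewrite (sphere_mom_seq us); last first.
  by move=> w h; rewrite mem_undup !mem_cat h !orbT.
rewrite (@sphere_mom_seq s P us); last first.
  by move=> w h; rewrite mem_undup !mem_cat h.
rewrite (@sphere_mom_seq s S us); last first.
  by move=> w h; rewrite mem_undup !mem_cat h !orbT.
rewrite mulr_sumr -big_split; apply: eq_bigr => w _ /=.
by rewrite mcoeffD mcoeffZ mulrDl mulrA.
Qed.
HB.instance Definition _ :=
  GRing.isLinear.Build C (poly3 R) C _ sphere_mom sphere_mom_linear.

Lemma sphere_momX w : sphere_mom (mpolyX C w) = cplx (mom w).
Proof. by rewrite /sphere_mom msuppX big_seq1 mcoeffX eqxx mul1r. Qed.

(** The infinitesimal rotation in the plane of the i-th and j-th axes. *)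
Definition rot i j P : poly3 R := var R i * mderiv j P - var R j * mderiv i P.

Lemma rot_linear i j : linear (rot i j).
Proof.
move=> c P S; rewrite /rot !linearP /= !mulrDr -!scalerAr scalerBr opprD.
exact: addrACA.
Qed.
HB.instance Definition _ i j :=
  GRing.isLinear.Build C (poly3 R) (poly3 R) _ (rot i j) (@rot_linear i j).

Lemma var_mderiv_X i j w :
  var R i * mderiv j (mpolyX C w) =
  (w j)%:R *: mpolyX C (mnm_add (mnm1 i) (mnm_sub w (mnm1 j))).
Proof. by rewrite mderivX -scalerAr /var mpolyXD. Qed.

(** Rotation invariance of the integral over the sphere. The three pairs of axes
    suffice, as exchanging i and j changes the sign of [rot i j]. *)
Lemma sphere_mom_rot i j P : (i, j) \in [:: (i0, i1); (i1, i2); (i0, i2)] ->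
  sphere_mom (rot i j P) = 0.
Proof.
move=> ij; rewrite [P]mpolyE !linear_sum big1 //= => w _.
rewrite 2!linearZ /=; apply/eqP; rewrite mulf_eq0; apply/orP; right; apply/eqP.
rewrite /rot 2!var_mderiv_X linearB /= 2!linearZ /= 2!sphere_momX.
rewrite -2!cplx_nat -2!cplxM; apply/eqP; rewrite subr_eq0; apply/eqP; congr cplx.
move: ij; rewrite !inE => /or3P[] /eqP[-> ->]; rewrite /mom !mnmDE !mnmBE !mnm1E /=
  ?subn0 ?add0n ?add1n ?subn1.
- exact: moment_xy.
- exact: moment_yz.
- exact: moment_xz.
Qed.

End SphereFunctional.

(** * Orthogonality of harmonic polynomials on the sphere *)

Section Casimir.
Variables (F : fieldType) (A : comAlgType F) (D : 'I_3 -> {linear A -> A}).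
Variable x : 'I_3 -> A.
Hypothesis D_mul : forall i a b, D i (a * b) = D i a * b + a * D i b.
Hypothesis D_x : forall i j, D i (x j) = (j == i)%:R.
Hypothesis D_comm : forall i j a, D i (D j a) = D j (D i a).

(** The infinitesimal rotation in the plane of x i and x j. *)
Definition alg_rot i j (a : A) : A := x i * D j a - x j * D i a.

Lemma alg_rotM i j a b : alg_rot i j (a * b) = alg_rot i j a * b + a * alg_rot i j b.
Proof. by rewrite /alg_rot !D_mul; ring. Qed.

(** The sum of the squares of the infinitesimal rotations acts on harmonic
    functions of degree m as the scalar - m (m + 1). *)
Lemma alg_casimir (m : nat) a : alg_euler D x a = m%:R *: a ->
  D i0 (D i0 a) + D i1 (D i1 a) + D i2 (D i2 a) = 0 ->
  alg_rot i0 i1 (alg_rot i0 i1 a) + alg_rot i1 i2 (alg_rot i1 i2 a) +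
  alg_rot i0 i2 (alg_rot i0 i2 a) = - (m * m + m)%:R *: a.
Proof.
rewrite /alg_euler sum3 scaler_nat -(mulr_natl a m) => e l.
(* The Euler identity for the derivatives of a, of degree m - 1. *)
have ek k : x i0 * D k (D i0 a) + x i1 * D k (D i1 a) + x i2 * D k (D i2 a) =
    m%:R * D k a - D k a.
  have := congr1 (D k) e; rewrite mulr_natl linearMn !linearD /= !D_mul !D_x.
  rewrite -(mulr_natl (D k a)) => <-.
  by case: (ord3P k) => -> /=; ring.
rewrite scaleNr scaler_nat -(mulr_natl a).
rewrite /alg_rot !linearB /= !D_mul !D_x /=.
rewrite (D_comm i1 i0) (D_comm i2 i1) (D_comm i2 i0).
have := ek i0; have := ek i1; have := ek i2.
rewrite (D_comm i1 i0) (D_comm i2 i1) (D_comm i2 i0).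
move: e l; move: (D i0 a) (D i1 a) (D i2 a) (D i0 (D i0 a)) (D i1 (D i1 a)) (D i2 (D i2 a))
  (D i0 (D i1 a)) (D i1 (D i2 a)) (D i0 (D i2 a)).
move: (x i0) (x i1) (x i2) => x0 x1 x2 a0 a1 a2 a00 a11 a22 a01 a12 a02 e l e2 e1 e0.
rewrite natrD natrM.
transitivity ((x0 * x0 + x1 * x1 + x2 * x2) * (a00 + a11 + a22)
  - x0 * (x0 * a00 + x1 * a01 + x2 * a02) - x1 * (x0 * a01 + x1 * a11 + x2 * a12)
  - x2 * (x0 * a02 + x1 * a12 + x2 * a22) - 2 * (x0 * a0 + x1 * a1 + x2 * a2)).
  by ring.
rewrite l e0 e1 e2 e.
transitivity ((- (m%:R - 1)) * (x0 * a0 + x1 * a1 + x2 * a2) - 2 * (m%:R * a)).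
  by ring.
by rewrite e; ring.
Qed.

End Casimir.

Section Orthogonality.
Variable R : realType.
Local Notation C := (Cx R).
Implicit Types (P S H K : poly3 R).

Lemma lap1 P : lap 1%:M P =
  mderiv i0 (mderiv i0 P) + mderiv i1 (mderiv i1 P) + mderiv i2 (mderiv i2 P).
Proof.
apply: (etrans _ (sum3 (fun j => mderiv j (mderiv j P)))); apply: eq_bigr => j _.
rewrite invmx1 (bigD1 j) //= big1 ?addr0; last first.
  by move=> k /negPf kj; rewrite mxE eq_sym kj scale0r.
by rewrite mxE eqxx scale1r.
Qed.

Lemma rotM i j P S : rot i j (P * S) = rot i j P * S + P * rot i j S.
Proof. exact: (alg_rotM (@var R) (@mderivM 3 C)). Qed.

(** The sum of the squares of the infinitesimal rotations. *)
Definition casimir P : poly3 R :=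
  rot i0 i1 (rot i0 i1 P) + rot i1 i2 (rot i1 i2 P) + rot i0 i2 (rot i0 i2 P).

Lemma casimir_Har m H : Har 1%:M m H -> casimir H = - (m * m + m)%:R *: H.
Proof.
move=> [kH hH].
apply: (@alg_casimir _ _ (@mderiv 3 C) (@var R) (@mderivM 3 C) (@mderiv_var R)).
- by move=> i j P; exact: mderiv_comm.
- exact: (euler_homog hH).
- exact: (etrans (esym (lap1 H)) kH).
Qed.

Lemma sphere_momD P S : sphere_mom (P + S) = sphere_mom P + sphere_mom S.
Proof. exact: linearD. Qed.

Lemma sphere_momZ c P : sphere_mom (c *: P) = c * sphere_mom P.
Proof. exact: linearZ. Qed.

(** Infinitesimal rotations are antisymmetric for the product on the sphere. *)
Lemma sphere_mom_rotM i j P S : (i, j) \in [:: (i0, i1); (i1, i2); (i0, i2)] ->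
  sphere_mom (rot i j P * S) = - sphere_mom (P * rot i j S).
Proof.
move=> ij; apply/eqP; rewrite -addr_eq0; apply/eqP.
apply: (etrans (esym (sphere_momD _ _))).
by rewrite -rotM; exact: sphere_mom_rot.
Qed.

Lemma sphere_mom_casimir P S :
  sphere_mom (casimir P * S) = sphere_mom (P * casimir S).
Proof.
have e i j : (i, j) \in [:: (i0, i1); (i1, i2); (i0, i2)] ->
    sphere_mom (rot i j (rot i j P) * S) = sphere_mom (P * rot i j (rot i j S)).
  move=> ij; apply: (etrans (sphere_mom_rotM (rot i j P) S ij)).
  exact: (etrans (congr1 -%R (sphere_mom_rotM P (rot i j S) ij)) (opprK _)).
rewrite /casimir 2!mulrDl 2!mulrDr 4!sphere_momD.
exact: (congr2 +%R (congr2 +%R (e i0 i1 isT) (e i1 i2 isT)) (e i0 i2 isT)).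
Qed.

(** Harmonic polynomials of different degrees are orthogonal on the sphere:
    they are eigenvectors of the symmetric operator [casimir] for different
    eigenvalues. *)
Lemma sphere_mom_Har m k H K : m != k -> Har 1%:M m H -> Har 1%:M k K ->
  sphere_mom (H * K) = 0.
Proof.
move=> mk hH hK; have := sphere_mom_casimir H K.
rewrite (casimir_Har hH) (casimir_Har hK) -scalerAl -scalerAr 2!sphere_momZ.
move/eqP; rewrite -subr_eq0 -mulrBl mulf_eq0 => /orP[|/eqP //].
rewrite opprK addrC subr_eq0 eqr_nat => /eqP e; case/eqP: mk.
by nia.
Qed.

(** Complex conjugation of the coefficients. *)
Definition conj_poly P : poly3 R := map_mpoly (Num.conj : C -> C) P.

Lemma mcoeff_conj w P : mcoeff w (conj_poly P) = (mcoeff w P)^*.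
Proof. exact: mcoeff_map_mpoly. Qed.

Lemma conj_polyD P S : conj_poly (P + S) = conj_poly P + conj_poly S.
Proof. exact: rmorphD. Qed.

Lemma conj_polyM P S : conj_poly (P * S) = conj_poly P * conj_poly S.
Proof. exact: rmorphM. Qed.

Lemma conj_poly_sum (I : Type) (s : seq I) (f : I -> poly3 R) :
  conj_poly (\sum_(i <- s) f i) = \sum_(i <- s) conj_poly (f i).
Proof. exact: rmorph_sum. Qed.

Lemma conj_polyC c : conj_poly (mpolyC 3 c) = mpolyC 3 c^*.
Proof. exact: map_mpolyC. Qed.

Lemma conj_poly_var i : conj_poly (var R i) = var R i.
Proof. exact: map_mpolyX. Qed.

Lemma pval_conj P u : pval (conj_poly P) (real_row u) = (pval P (real_row u))^*.
Proof.
elim/poly3_ind: P => [c|i|P S hP hS|P S hP hS].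
- by rewrite conj_polyC 2!pvalC.
- rewrite conj_poly_var pval_var mxE; apply/esym/CrealP.
  by rewrite complex_real.
- rewrite conj_polyD 2!pvalD rmorphD; exact: (congr2 +%R hP hS).
- rewrite conj_polyM 2!pvalM rmorphM; exact: (congr2 *%R hP hS).
Qed.

Lemma V_conj m P : V m P -> V m (conj_poly P).
Proof.
move=> /dhomogP hP; apply/dhomogP => w; rewrite mcoeff_msupp mcoeff_conj => h.
apply: hP; rewrite mcoeff_msupp; apply: contra h => /eqP ->.
by rewrite rmorph0.
Qed.

Lemma mderiv_conj i P : mderiv i (conj_poly P) = conj_poly (mderiv i P).
Proof.
apply/mpolyP => w; rewrite mcoeff_mderiv !mcoeff_conj mcoeff_mderiv.
by rewrite rmorphMn.
Qed.

Lemma Har_conj m H : Har 1%:M m H -> Har 1%:M m (conj_poly H).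
Proof.
move=> [kH hH]; split; last exact: V_conj.
rewrite /Ker lap1 !mderiv_conj -!conj_polyD -lap1.
by rewrite (_ : lap _ _ = 0) // -(mpolyC0 3 C) conj_polyC rmorph0.
Qed.

End Orthogonality.

(** * The Hermitian product *)

Section SphereProduct.
Variable R : realType.
Local Notation C := (Cx R).
Implicit Types (P S H K f g : poly3 R).

Lemma sphere_Rint_ext (f g : 'rV[R]_3 -> R) :
  (forall theta phi, f (sphere_point theta phi) = g (sphere_point theta phi)) ->
  sphere_Rint f = sphere_Rint g.
Proof.
move=> fg; apply: eq_Rintegral => theta _; apply: (congr2 *%R _ (erefl _)).
by apply: eq_Rintegral => phi _; exact: fg.
Qed.

Lemma sphere_int_ext (f g : 'rV[R]_3 -> C) :
  (forall theta phi, f (sphere_point theta phi) = g (sphere_point theta phi)) ->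
  sphere_int f = sphere_int g.
Proof.
move=> fg; apply: (congr2 (@Complex R)); apply: sphere_Rint_ext => theta phi.
  by rewrite fg.
by rewrite fg.
Qed.

(** The Hermitian product over Upsilon_Q is an integral over the real sphere of
    polynomials in the coordinates where the form is a sum of squares. *)
Lemma herm_sphere_mom (A : 'M[C]_3) f g :
  herm A f g = sphere_mom (act (invmx A) f * conj_poly (act (invmx A) g)).
Proof.
apply: (etrans _ (sphere_int_pval _)); apply: sphere_int_ext => theta phi.
apply: (etrans _ (esym (pvalM _ _ _))); apply: (congr2 *%R).
  exact: esym (pval_act _ _ _).
apply: (etrans _ (esym (pval_conj _ _))).
have e := pval_act (invmx A) g (real_row (sphere_point theta phi)).
exact: (congr1 (fun z : C => z^*) (esym e)).
Qed.

Lemma pval_Qf1_sphere theta phi :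
  pval (Qf 1%:M) (real_row (sphere_point theta phi)) = 1 :> C.
Proof.
rewrite pval_Qf mulmx1 mxE sum3 !mxE /=.
rewrite -!rmorphM -!rmorphD /= -[RHS](rmorph1 (real_complex R)); congr (real_complex R _).
have hc := cos2Dsin2 phi; have ht := cos2Dsin2 theta.
have -> : sin theta * cos phi * (sin theta * cos phi) +
  sin theta * sin phi * (sin theta * sin phi) + cos theta * cos theta =
  sin theta ^+ 2 * (cos phi ^+ 2 + sin phi ^+ 2) + cos theta ^+ 2 by ring.
by rewrite hc mulr1 addrC ht.
Qed.

(** On the unit sphere the powers of the quadratic form equal 1. *)
Lemma sphere_mom_QX k l H K :
  sphere_mom (Qf 1%:M ^+ k * H * conj_poly (Qf 1%:M ^+ l * K)) =
  sphere_mom (H * conj_poly K).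
Proof.
apply: (etrans (esym (sphere_int_pval _))); apply: (etrans _ (sphere_int_pval _)).
apply: sphere_int_ext => theta phi.
have e n P : pval (Qf 1%:M ^+ n * P) (real_row (sphere_point theta phi)) =
    pval P (real_row (sphere_point theta phi)).
  by rewrite pvalM pvalX pval_Qf1_sphere expr1n mul1r.
apply: (etrans (pvalM _ _ _)); apply: (etrans _ (esym (pvalM _ _ _))).
apply: (congr2 *%R (e k H)); apply: (etrans (pval_conj _ _)).
apply: (etrans _ (esym (pval_conj _ _))); exact: (congr1 (fun z : C => z^*) (e l K)).
Qed.

(** If the integral of |S|^2 is zero, then S vanishes on the sphere, off the poles
    and the meridian phi = 0: the inner integral I vanishes for each theta,
    and then so does the integrand. *)
Lemma sphere_pos_zero S theta phi : sphere_mom (S * conj_poly S) = 0 ->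
  0 < theta < pi -> 0 < phi < 2 * pi ->
  pval S (real_row (sphere_point theta phi)) = 0.
Proof.
move=> S0 ht hp; set G := S * conj_poly S in S0.
pose c w := complex.Re (mcoeff w G).
pose F u := \sum_(w <- msupp G) c w * monom_val w u.
have FE u : F u = complex.Re (pval S (real_row u) * (pval S (real_row u))^*).
  by rewrite -pval_conj -pvalM pval_real_row Re_sum.
have F0 u : 0 <= F u.
  rewrite FE; have := mul_conjC_ge0 (pval S (real_row u)).
  by rewrite lecE => /andP[].
pose I t := \sum_(w <- msupp G) c w * phi_int R (w i1) (w i0) *
  trig (w i0 + w i1) (w i2) t.
have IE t : (\int[lebesgue_measure]_(p in `[0%R, (2 * pi)%R])
    F (sphere_point t p))%R = I t by exact: inner_Rint.
have I0 t : 0 <= I t by rewrite -IE; apply: Rintegral_ge0 => p _; exact: F0.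
have cI : continuous I by apply: continuous_sum => w; exact: continuous_trig.
have int0 : (\int[lebesgue_measure]_(t in `[0%R, pi%R]) (I t * sin t) = 0)%R.
  have z : sphere_Rint F = 0.
    have := congr1 (@complex.Re R) S0; rewrite /sphere_mom Re_sum /=.
    by rewrite -(sphere_Rint_sum (msupp G) c).
  apply: (etrans _ z); apply: eq_Rintegral => t _.
  by rewrite IE.
have It : I theta = 0.
  have cIs : continuous (fun t => I t * sin t).
    by move=> t; apply: cvgM; [exact: cI | exact: continuous_sin].
  have : I theta * sin theta = 0.
    apply: (Rintegral_eq0 cIs _ int0 ht) => t ht'.
    by rewrite mulr_ge0 // sin_ge0_pi.
  move/eqP; rewrite mulf_eq0 => /orP[/eqP //|/eqP s0].
  by have := sin_gt0_pi ht; rewrite s0 ltxx.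
have cF : continuous (fun p => F (sphere_point theta p)).
  have -> : (fun p => F (sphere_point theta p)) = fun p =>
      \sum_(w <- msupp G) (c w * trig (w i0 + w i1) (w i2) theta) * trig (w i1) (w i0) p.
    apply/funext => p; apply: eq_bigr => w _.
    by rewrite monom_val_sphere mulrA.
  by apply: continuous_sum => w; exact: continuous_trig.
have Fz : F (sphere_point theta phi) = 0.
  apply: (Rintegral_eq0 cF _ _ hp); first by move=> p _; exact: F0.
  by rewrite IE.
move: Fz; rewrite FE; move: (pval S _) => z h.
apply/eqP; rewrite -mul_conjC_eq0; apply/eqP.
have := mul_conjC_ge0 z; rewrite lecE => /andP[/eqP im _].
by apply/eqP; rewrite eq_complex h im /= !eqxx.
Qed.

(** The Hermitian product is definite on homogeneous polynomials. *)
Lemma sphere_mom_definite e S : V e S -> sphere_mom (S * conj_poly S) = 0 -> S = 0.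
Proof.
move=> VS S0.
(* The points (y, 1, z) are multiples of points of the open half sphere where
   the second coordinate is positive, with phi = pi/2 - atan y and
   theta = pi/2 - atan (z sin phi). *)
have chart (y z : R) : pval S (real_row (\row_i [:: y; 1; z]`_i)) = 0.
  pose phi := pi / 2 - atan y.
  have sphi : sin phi = cos (atan y) by rewrite /phi sinB sin_pihalf cos_pihalf; ring.
  have cphi : cos phi = sin (atan y) by rewrite /phi cosB sin_pihalf cos_pihalf; ring.
  pose t := z * sin phi; pose theta := pi / 2 - atan t.
  have sth : sin theta = cos (atan t).
    by rewrite /theta sinB sin_pihalf cos_pihalf; ring.
  have cth : cos theta = sin (atan t).
    by rewrite /theta cosB sin_pihalf cos_pihalf; ring.
  have cpos (x : R) : 0 < cos (atan x).
    by apply: cos_gt0_pihalf; rewrite atan_gtNpi2 atan_ltpi2.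
  have tanE (x : R) : sin (atan x) = x * cos (atan x).
    have := atanK x; rewrite /tan => {2}<-.
    by rewrite divfK // lt0r_neq0.
  have bd (x : R) : 0 < pi / 2 - atan x < pi.
    have := atan_gtNpi2 x; have := atan_ltpi2 x; lra.
  have z0 : pval S (real_row (sphere_point theta phi)) = 0.
    apply: (sphere_pos_zero S0); first exact: bd.
    have /andP[p0 p1] := bd y; have pp := pi_gt0 R.
    by apply/andP; split; [exact: p0 | apply: (lt_trans p1); lra].
  have s1 := cpos y; have s2 := cpos t.
  pose l := (cos (atan t) * cos (atan y))^-1.
  have -> : real_row (\row_i [:: y; 1; z]`_i) =
      cplx l *: real_row (sphere_point theta phi).
    apply/rowP => i; rewrite !mxE -cplxM; congr (real_complex R _).
    rewrite sth cth sphi cphi !tanE /l /t sphi.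
    have n1 : cos (atan y) != 0 by rewrite lt0r_neq0.
    have n2 : cos (atan t) != 0 by rewrite lt0r_neq0.
    move: n1 n2; rewrite /t sphi; move: (cos (atan y)) => a.
    move: (cos (atan _)) => b n1 n2.
    by case: (ord3P i) => -> /=; field; rewrite n1 n2.
  by rewrite (pval_homog _ _ VS) z0 mulr0.
have var1_neq0 : var R i1 != 0.
  apply/eqP => /(congr1 (fun P => pval P (const_mx 1))).
  by rewrite pval_var pval0 mxE => /eqP; rewrite oner_eq0.
have /eqP : var R i1 * S = 0.
  apply: poly3_nat_eq0 => w; rewrite pvalM pval_var mxE.
  have [->|w1] := eqVneq (w i1) 0%N; first by rewrite mul0r.
  pose a : R := (w i1)%:R; have a0 : a != 0 by rewrite pnatr_eq0.
  have -> : \row_i (w i)%:R = cplx a *: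
      real_row (\row_i [:: (w i0)%:R / a; 1; (w i2)%:R / a]`_i) :> 'rV[C]_3.
    apply/rowP => i; rewrite !mxE -cplxM -cplx_nat; congr cplx.
    case: (ord3P i) => -> /=.
    - by rewrite mulrC divfK.
    - by rewrite mulr1.
    - by rewrite mulrC divfK.
  by rewrite (pval_homog _ _ VS) chart !mulr0.
by rewrite mulf_eq0 (negPf var1_neq0) => /eqP.
Qed.

End SphereProduct.

(** * The orthogonal decomposition *)

Section HarmonicDecomposition.
Variable R : realType.
Local Notation C := (Cx R).
Implicit Types (P S T f g : poly3 R) (d k l : nat).
Variable B : 'M[C]_3.
Hypotheses (B_sym : B^T = B) (B_unit : B \in unitmx).

Lemma QHar_V d k P : (2 * k <= d)%N -> QHar B d k P -> V d P.
Proof.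
move=> kd [H [_ hH] ->]; have := V_QX B k hH.
by have -> : (2 * k + (d - 2 * k) = d)%N by lia.
Qed.

Lemma exists_unique_decomposition d P : V d P ->
  exists! p : {ffun 'I_(d./2).+1 -> poly3 R},
    (forall k : 'I_(d./2).+1, QHar B d k (p k)) /\ P = \sum_k p k.
Proof.
move=> hP; have [h [hh eP]] := harmonic_decomposition B_sym B_unit hP.
have kd (k : 'I_(d./2).+1) : (2 * k <= d)%N by have := ltn_ord k; lia.
exists [ffun k : 'I_(d./2).+1 => Qf B ^+ k * h k]; split.
  split; first by move=> k; rewrite ffunE; exists (h k) => //; exact: hh.
  by rewrite {1}eP; apply: eq_bigr => k _; rewrite ffunE.
move=> p [hp ep].
have ex k : exists H, (k < (d./2).+1)%N ->
    Har B (d - 2 * k) H /\ p (inord k) = Qf B ^+ k * H.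
  have [kn|kn] := ltnP k (d./2).+1; last by exists 0.
  by have [H hH e] := hp (inord k); exists H => _; move: hH e; rewrite inordK.
have [h' hh'] := choice ex.
have eh' (k : 'I_(d./2).+1) : p k = Qf B ^+ k * h' k.
  by have [_ <-] := hh' k (ltn_ord k); rewrite inord_val.
have z : forall k, (k < (d./2).+1)%N -> h k - h' k = 0.
  apply: (@harmonic_decomposition_inj _ B B_sym B_unit _ d) => [k kn|].
    have kd' : (2 * k <= d)%N by lia.
    by split; [exact: kd' | exact: (HarB (hh k kd') (hh' k kn).1)].
  have e : \sum_(k < (d./2).+1) Qf B ^+ k * h k = \sum_(k < (d./2).+1) Qf B ^+ k * h' k.
    apply: (etrans (esym eP)); apply: (etrans ep).
    by apply: eq_bigr => k _; exact: eh'.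
  under eq_bigr => k _ do rewrite mulrBr.
  by rewrite sumrB; apply/eqP; rewrite subr_eq0; apply/eqP; exact: e.
apply/ffunP => k; rewrite ffunE eh'; congr (_ * _).
by apply/eqP; rewrite -subr_eq0; apply/eqP; exact: z.
Qed.

Variable A : 'M[C]_3.
Hypotheses (A_unit : A \in unitmx) (B_A : B = A *m A^T).

(** In the coordinates v A the form is a sum of squares. *)
Lemma normal_form : invmx A *m B *m (invmx A)^T = 1%:M.
Proof.
have AT : A^T \in unitmx by rewrite unitmx_tr.
by rewrite B_A mulmxA mulVmx // mul1mx trmx_inv mulmxV.
Qed.

Lemma QHar_normal_form d k f : QHar B d k f ->
  exists2 H, Har 1%:M (d - 2 * k) H & act (invmx A) f = Qf 1%:M ^+ k * H.
Proof.
move=> [H [kH hH] ->]; exists (act (invmx A) H).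
  split; last exact: V_act.
  have AU : invmx A \in unitmx by rewrite unitmx_inv.
  rewrite /Ker -normal_form (lap_act H B_unit AU).
  by rewrite (_ : lap B H = 0) ?linear0.
by rewrite actM actX act_Qf normal_form.
Qed.

Lemma herm_QHar d k l f g : (2 * k <= d)%N -> (2 * l <= d)%N -> k <> l ->
  QHar B d k f -> QHar B d l g -> herm A f g = 0.
Proof.
move=> kd ld kl /QHar_normal_form[H hH eH] /QHar_normal_form[K hK eK].
apply: (etrans (herm_sphere_mom A f g)); rewrite eH eK.
apply: (etrans (sphere_mom_QX k l H K)).
by apply: (sphere_mom_Har _ hH (Har_conj hK)); apply/eqP; lia.
Qed.

Lemma herm_sumr (I : Type) (s : seq I) (f : poly3 R) (g : I -> poly3 R) :
  herm A f (\sum_(i <- s) g i) = \sum_(i <- s) herm A f (g i).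
Proof.
apply: (etrans (herm_sphere_mom A _ _)).
rewrite linear_sum conj_poly_sum mulr_sumr linear_sum /=.
by apply: eq_bigr => i _; exact: esym (herm_sphere_mom A _ _).
Qed.

Lemma hermDl f f' g : herm A (f + f') g = herm A f g + herm A f' g.
Proof.
apply: (etrans (herm_sphere_mom A _ _)); rewrite actD mulrDl sphere_momD.
exact: esym (congr2 +%R (herm_sphere_mom A _ _) (herm_sphere_mom A _ _)).
Qed.

Lemma Har_herm_VQ d P T : Har B d P -> VQ B d T -> herm A P T = 0.
Proof.
move=> hP; have qP : QHar B d 0 P.
  by exists P; [rewrite muln0 subn0 | rewrite expr0 mul1r].
case: d hP qP => [|[|e]] _ qP /= => [-> | -> | [S hS ->]].
- by rewrite -(big_nil 0 +%R xpredT (fun _ : nat => 0 : poly3 R)) herm_sumr big_nil.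
- by rewrite -(big_nil 0 +%R xpredT (fun _ : nat => 0 : poly3 R)) herm_sumr big_nil.
have [h [hh eS]] := harmonic_decomposition B_sym B_unit hS.
have -> : Qf B * S = \sum_(k < (e./2).+1) Qf B ^+ k.+1 * h k.
  rewrite [in LHS]eS mulr_sumr; apply: eq_bigr => k _.
  by rewrite mulrA -exprS.
rewrite herm_sumr big1 // => k _; have ke := ltn_ord k.
apply: (@herm_QHar e.+2 0 k.+1) => //; first by lia.
exists (h k); last exact: erefl.
have -> : (e.+2 - 2 * k.+1 = e - 2 * k)%N by lia.
by apply: hh; lia.
Qed.

Lemma herm_definite d k S : V d S -> herm A (Qf B ^+ k * S) (Qf B ^+ k * S) = 0 ->
  S = 0.
Proof.
move=> hS /(etrans (esym (herm_sphere_mom A _ _))).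
rewrite actM actX act_Qf normal_form.
move/(etrans (esym (sphere_mom_QX k k _ _)))/(sphere_mom_definite (V_act _ hS)) => e.
by rewrite -(actVK S A_unit) e linear0.
Qed.

(** Conversely, write P = h + Q S with h harmonic: then Q S is orthogonal to
    itself. *)
Lemma Har_of_herm d P : V d P -> (forall T, VQ B d T -> herm A P T = 0) -> Har B d P.
Proof.
case: d => [|[|e]] hP orth.
- by split; [exact: (@lap_small _ B 0 P isT hP) | exact: hP].
- by split; [exact: (@lap_small _ B 1 P isT hP) | exact: hP].
have [h [hh eP]] := harmonic_decomposition B_sym B_unit hP.
have h0 : Har B e.+2 (h 0%N) by have := hh 0%N isT; rewrite muln0 subn0.
pose S := \sum_(k < (e./2).+1) Qf B ^+ k * h k.+1.
have hS : V e S.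
  apply: V_sum => k _; have ke := ltn_ord k.
  have hk : V (e - 2 * k) (h k.+1).
    have -> : (e - 2 * k = e.+2 - 2 * k.+1)%N by lia.
    by apply: (hh k.+1 _).2; lia.
  have := V_QX B k hk; by have -> : (2 * k + (e - 2 * k) = e)%N by lia.
have eP' : P = h 0%N + Qf B * S.
  rewrite {1}eP big_ord_recl /= expr0 mul1r mulr_sumr; congr (_ + _).
  by apply: eq_bigr => k _; rewrite mulrA -exprS.
have vQ : VQ B e.+2 (Qf B * S) by exists S.
have := orth _ vQ; rewrite {1}eP' hermDl (Har_herm_VQ h0 vQ) add0r => z.
have S0 : S = 0 by apply: (@herm_definite e 1 S hS); rewrite expr1.
by rewrite eP' S0 mulr0 addr0.
Qed.

End HarmonicDecomposition.

(** * Harmonic decomposition, Dirichlet problem and Maxwell representation *)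

Theorem theorem12 (R : realType) (B : 'M[Cx R]_3)
    (B_sym : B^T = B) (B_unit : B \in unitmx) :
  (* (1) *)
  (forall d : nat,
     (forall k, (2 * k <= d)%N -> forall P, QHar B d k P -> V d P) /\
     (forall P, V d P ->
        exists! p : {ffun 'I_(d./2).+1 -> poly3 R},
          (forall k : 'I_(d./2).+1, QHar B d k (p k)) /\ P = \sum_k p k) /\
     (forall g, OQ B g ->
        (forall P, V d P -> V d (act g P)) /\
        (forall k, (2 * k <= d)%N ->
           forall P, QHar B d k P -> QHar B d k (act g P))) /\
     (forall A : 'M[Cx R]_3, A \in unitmx -> B = A *m A^T ->
        (forall k l, (2 * k <= d)%N -> (2 * l <= d)%N -> k <> l ->
           forall f g, QHar B d k f -> QHar B d l g -> herm A f g = 0) /\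
        (forall P, V d P ->
           (Har B d P <-> forall T, VQ B d T -> herm A P T = 0)))) /\
  (* (2) *)
  (forall (c : Cx R) (F : poly3 R),
     exists P, Ker B P /\ (forall v, surface B c v -> pval P v = pval F v)) /\
  (* (3) *)
  (forall (c : Cx R) (M N : poly3 R),
     exists! P, lap B P = M /\ (forall v, surface B c v -> pval P v = pval N v)) /\
  (* (4) *)
  (forall (d : nat) (P : poly3 R), Ker B P -> deg_le d P ->
     maxwell_rep B d d.+1 (fun k => d - k)%N P) /\
  (forall (d : nat) (c : Cx R) (P : poly3 R), deg_le d P ->
     exists P', (forall v, surface B c v -> pval P' v = pval P v) /\
       maxwell_rep B d d.+1 (fun k => d - k)%N P') /\
  (forall (d : nat) (P : poly3 R), V d P ->
     maxwell_rep B d (d./2).+1 (fun k => d - 2 * k)%N P).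
Proof.
split.
  move=> d; split; first by move=> k kd P; exact: QHar_V.
  split; first by move=> P; exact: exists_unique_decomposition.
  split.
    move=> g hg; split; first by move=> P; exact: V_act.
    by move=> k _ P; exact: QHar_act.
  move=> A AU eA; split.
    by move=> k l kd ld kl f g; exact: (herm_QHar B_unit AU eA kd ld kl).
  move=> P hP; split; last exact: (Har_of_herm B_sym B_unit AU eA hP).
  by move=> hH T; exact: (Har_herm_VQ B_sym B_unit AU eA hH).
split.
  move=> c F; have [d dF] := deg_le_ex F.
  have [P [kP _ eP]] := harmonic_restriction B_sym B_unit c dF.
  by exists P; split; [exact: kP | exact: eP].
split; first by move=> c M N; exact: dirichlet.
split; first by move=> d P; exact: maxwell_rep_Ker.
split; last by move=> d P; exact: maxwell_rep_homog.
move=> d c P dP.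
have [P' [kP' dP' eP']] := harmonic_restriction B_sym B_unit c dP.
exists P'; split; first exact: eP'.
exact: maxwell_rep_Ker.
Qed.
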